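(* Let $1<\beta<2$ and $r<0$. Let $u$ be the solution of the Caputo fractional initial value problem $$D^\beta_t u-ru=0,\quad t>0,\qquad u(0)=1,\quad u'(0)=1,$$ namely $u(t)=E_\beta(rt^\beta)+t\,E_{\beta,2}(rt^\beta)$. Then $$\beta=1-\lim_{t\to\infty}\frac{t\,u'(t)}{u(t)}.$$
   Context: For $n-1<\beta<n$, $n\in\mathbb{N}$, the Caputo fractional derivative (lower terminal $0$) is $(D^\beta_t f)(t)=\frac{1}{\Gamma(n-\beta)}\int_0^t (t-\tau)^{n-\beta-1}f^{(n)}(\tau)\,d\tau$, $t>0$. The Mittag-Leffler functions are $E_\alpha(z)=\sum_{k\ge0}\frac{z^k}{\Gamma(k\alpha+1)}$ and $E_{\alpha,\beta}(z)=\sum_{k\ge0}\frac{z^k}{\Gamma(k\alpha+\beta)}$. *)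

(* Defs.v *)
From Stdlib Require Import Reals Lra ClassicalEpsilon Arith Factorial.
Open Scope R_scope.

Fixpoint prod_shift (x : R) (n : nat) : R :=
  match n with
  | O => x
  | S m => prod_shift x m * (x + INR (S m))
  end.

(* Euler's Gamma function, via the Euler–Gauss limit formula
   Gamma x = lim_{n->oo} n! n^x / (x (x+1) ... (x+n)),
   valid for x not a nonpositive integer (we only use x > 0). *)
Definition Gamma (x : R) : R :=
  epsilon (inhabits 0)
    (fun l => Un_cv (fun n => INR (fact n) * Rpower (INR n) x / prod_shift x n) l).

Definition ML2 (a b z : R) : R :=
  epsilon (inhabits 0)
    (fun l => infinite_sum (fun k => z ^ k / Gamma (INR k * a + b)) l).

Definition ML (a z : R) : R := ML2 a 1 z.

Definition lim_pinfty (f : R -> R) (l : R) : Prop :=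
  forall eps, eps > 0 -> exists M, forall t, t > M -> Rabs (f t - l) < eps.

(* Main.v *)
Require Import Defs.
From Stdlib Require Import Reals Lra Lia Factorial ClassicalEpsilon.
From Coquelicot Require Import Coquelicot.
Open Scope R_scope.

(** Along a Hankel contour made of the rays [arg s = +-phi] and an arc of radius [R], with
    [PI/2 < phi < PI/beta], put
      [h(z)   = int e^s s^(-z) ds]   and   [J_b(x) = int e^s s^(beta-b) / (s^beta + x) ds].
    Neither depends on [R]: the zeros of [s^beta + x] lie outside the sector [|arg s| <= phi].
    Integration by parts gives [h(z) = z h(z+1)]; taking [R = n] and comparing with [h(n+1) = h(1)/n!]
    gives [n! n^z h(z+n+1) -> h(1)], so [h(z) = h(1) / Gamma(z)] for Gauss's [Gamma], and the value of
    [h(1) > 0] is irrelevant. The identity [h(b) = J_b(x) + x J_{b+beta}(x)] does the rest: iterated with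
    [R^beta > x] it shows [J_b(x) = sum_k (-x)^k h(b + beta k) = h(1) E_{beta,b}(-x)]; used once with
    [R = 1], where [J_b(x) = O(1/x)], it shows [x J_b(x) -> h(b - beta)].
    With [x = -r t^beta], [h(1) u = J_1 + t J_2] and [h(1) t u' = J_0 + t J_1], so [t u'/u] tends to
    [h(1-beta) / h(2-beta) = 1 - beta].

    Contours are parametrised by [zeta = w + i th] with [s = exp zeta], so that all powers of [s] are entire
    in [zeta], and complex functions are pairs of real functions of [(w, th)]. *)

(** * Holomorphic pairs on a strip and Cauchy's theorem on rectangles *)

(* [A + i B] is holomorphic in [zeta = w + i th] for [|th| < m], with derivative [A' + i B']. *)
Record holomorphic_strip (m : R) (A B A' B' : R -> R -> R) : Prop := {
  hol_A_w : forall w th, Rabs th < m -> is_derive (fun v => A v th) w (A' w th);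
  hol_B_w : forall w th, Rabs th < m -> is_derive (fun v => B v th) w (B' w th);
  hol_A_th : forall w th, Rabs th < m -> is_derive (fun v => A w v) th (- B' w th);
  hol_B_th : forall w th, Rabs th < m -> is_derive (fun v => B w v) th (A' w th);
  hol_A_cont : forall w th, Rabs th < m -> continuity_2d_pt A w th;
  hol_B_cont : forall w th, Rabs th < m -> continuity_2d_pt B w th;
  hol_A'_cont : forall w th, Rabs th < m -> continuity_2d_pt A' w th;
  hol_B'_cont : forall w th, Rabs th < m -> continuity_2d_pt B' w th
}.

Lemma is_derive_continuous (f : R -> R) (x l : R) : is_derive f x l -> continuous f x.
Proof.
  intros H. apply (ex_derive_continuous (K := R_AbsRing) (V := R_NormedModule)).
  now exists l.
Qed.

Lemma continuity_2d_pt_snd (f : R -> R -> R) (x y : R) :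
  continuity_2d_pt f x y -> continuous (f x) y.
Proof.
  intros H. apply continuity_2d_pt_filterlim in H.
  apply (filterlim_comp _ _ _ (fun v => (x, v)) (fun z => f (fst z) (snd z)) _ (locally (x, y)) _);
    [| exact H].
  intros P [e He]. exists e. intros z Hz. apply He. split; [apply ball_center | exact Hz].
Qed.

Lemma continuity_2d_pt_fst (f : R -> R -> R) (x y : R) :
  continuity_2d_pt f x y -> continuous (fun v => f v y) x.
Proof.
  intros H. apply continuity_2d_pt_filterlim in H.
  apply (filterlim_comp _ _ _ (fun v => (v, y)) (fun z => f (fst z) (snd z)) _ (locally (x, y)) _);
    [| exact H].
  intros P [e He]. exists e. intros z Hz. apply He. split; [exact Hz | apply ball_center].
Qed.

(* Cauchy's theorem on the rectangle [W1, W2] x [0, phi]; the side on the real axis does not contribute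
   because B vanishes there. *)
Lemma cauchy_rectangle (m phi : R) (A B A' B' : R -> R -> R) (W1 W2 : R) :
  holomorphic_strip m A B A' B' -> 0 < phi < m -> (forall w, B w 0 = 0) ->
  RInt (A W2) 0 phi - RInt (A W1) 0 phi = RInt (fun w => B w phi) W1 W2.
Proof.
  intros hol Hphi HB0.
  assert (Hin : forall t, Rmin 0 phi <= t <= Rmax 0 phi -> Rabs t < m).
  { intros t Ht. rewrite Rmin_left in Ht by lra. rewrite Rmax_right in Ht by lra.
    rewrite Rabs_pos_eq; lra. }
  (* Differentiation under the integral sign gives the integral of [A' W], and by Cauchy-Riemann
     [A'] is also the [th]-derivative of [B]; the integral is therefore [B W phi - B W 0]. *)
  assert (HD : forall W, is_derive (fun W => RInt (A W) 0 phi) W (B W phi)).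
  { intros W.
    assert (E : RInt (fun t => Derive (fun u => A u t) W) 0 phi = B W phi).
    { apply is_RInt_unique.
      apply (is_RInt_ext (A' W)).
      { intros t Ht. symmetry. apply is_derive_unique, (hol_A_w _ _ _ _ _ hol).
        apply Hin. lra. }
      replace (B W phi) with (minus (B W phi) (B W 0))
        by (unfold minus, plus, opp; simpl; rewrite HB0; ring).
      apply (is_RInt_derive (B W)).
      - intros t Ht. apply (hol_B_th _ _ _ _ _ hol), Hin, Ht.
      - intros t Ht. apply continuity_2d_pt_snd, (hol_A'_cont _ _ _ _ _ hol), Hin, Ht. }
    rewrite <- E. apply is_derive_RInt_param.
    - apply filter_forall. intros v t Ht. exists (A' v t).
      apply (hol_A_w _ _ _ _ _ hol), Hin, Ht.
    - intros t Ht. specialize (Hin t Ht).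
      apply continuity_2d_pt_ext_loc with A'; [| apply (hol_A'_cont _ _ _ _ _ hol), Hin].
      assert (Hd : 0 < m - Rabs t) by lra.
      exists (mkposreal _ Hd). simpl. intros u v _ Hv. symmetry.
      apply is_derive_unique, (hol_A_w _ _ _ _ _ hol).
      pose proof (Rabs_triang_inv v t). lra.
    - apply filter_forall. intros v.
      apply (ex_RInt_continuous (V := R_CompleteNormedModule)). intros t Ht.
      apply (is_derive_continuous _ _ _ (hol_A_th _ _ _ _ _ hol v t (Hin t Ht))). }
  symmetry. apply is_RInt_unique.
  apply (is_RInt_derive (fun W => RInt (A W) 0 phi)).
  - intros W _. apply HD.
  - intros W _. apply (is_derive_continuous _ _ (B' W phi)).
    apply (hol_B_w _ _ _ _ _ hol). rewrite Rabs_pos_eq; lra.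
Qed.

(** * Hankel contour integrals: existence, bounds, linearity, exact integrands *)

(* With s = exp (w + i th) and A + i B = s F(s), this is, up to the factor pi, the integral of
   F(s) ds / (2 i pi) along the Hankel contour that follows the rays arg s = +-phi
   outside the disc of radius exp W. *)
Definition truncated_contour (phi : R) (A B : R -> R -> R) (W X : R) : R :=
  RInt (fun w => B w phi) W X + RInt (A W) 0 phi.

(** The same [l] is demanded for every [W], so that each estimate may pick the radius of the arc at
    will. *)
Definition is_contour (phi : R) (A B : R -> R -> R) (l : R) : Prop :=
  forall W, is_lim (truncated_contour phi A B W) p_infty l.

Lemma RInt_split (f : R -> R) (a b c : R) :
  (forall w, continuous f w) -> RInt f a b + RInt f b c = RInt f a c.
Proof.
  intros Hf. apply (RInt_Chasles (V := R_CompleteNormedModule));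
    apply (ex_RInt_continuous (V := R_CompleteNormedModule)); intros; apply Hf.
Qed.

Lemma abs_RInt_exp_le (f : R -> R) (C W X : R) :
  W <= X -> (forall w, continuous f w) ->
  (forall w, W <= w -> Rabs (f w) <= C * exp (- w)) ->
  Rabs (RInt f W X) <= C * (exp (- W) - exp (- X)).
Proof.
  intros HWX Hf Hb.
  apply (norm_RInt_le f (fun w => C * exp (- w)) W X (RInt f W X)); try assumption.
  - intros w Hw. apply Hb. lra.
  - apply (RInt_correct (V := R_CompleteNormedModule)),
      (ex_RInt_continuous (V := R_CompleteNormedModule)). intros; apply Hf.
  - replace (C * (exp (- W) - exp (- X)))
      with (minus (- C * exp (- X)) (- C * exp (- W)))
      by (unfold minus, plus, opp; simpl; ring).
    apply (is_RInt_derive (fun w => - C * exp (- w))).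
    + intros w _. auto_derive; [trivial | ring].
    + intros w _. apply (is_derive_continuous _ _ (- C * exp (- w))).
      auto_derive; [trivial | ring].
Qed.

Lemma is_lim_RInt_exp_dominated (f : R -> R) (C W : R) :
  (forall w, continuous f w) ->
  (forall w, W <= w -> Rabs (f w) <= C * exp (- w)) ->
  exists l : R, is_lim (RInt f W) p_infty l.
Proof.
  intros Hf Hb.
  assert (HC : 0 <= C).
  { pose proof (Hb W (Rle_refl W)) as H0. pose proof (Rabs_pos (f W)).
    pose proof (exp_pos (- W)). nra. }
  apply (proj1 (@filterlim_locally_cauchy R R_CompleteSpace (Rbar_locally' p_infty) _ (RInt f W))).
  intros eps.
  assert (Heps : 0 < eps / (C + 1)) by (apply Rdiv_lt_0_compat; [apply cond_pos | lra]).
  (* Beyond [M], [exp (- u) < eps / (C + 1)]; the denominator is [C + 1] because [C] may be zero. *)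
  set (M := Rmax W (- ln (eps / (C + 1)))).
  assert (key : forall u v, M < u -> u <= v -> Rabs (RInt f W v - RInt f W u) < eps).
  { intros u v Hu Huv.
    pose proof (Rmax_l W (- ln (eps / (C + 1)))). pose proof (Rmax_r W (- ln (eps / (C + 1)))).
    fold M in H, H0.
    assert (E : RInt f W v - RInt f W u = RInt f u v)
      by (pose proof (RInt_split f W u v Hf); lra).
    rewrite E.
    apply Rle_lt_trans with (C * (exp (- u) - exp (- v))).
    { apply abs_RInt_exp_le; try assumption. intros w Hw. apply Hb. lra. }
    assert (exp (- u) < eps / (C + 1)).
    { rewrite <- (exp_ln (eps / (C + 1))) by assumption. apply exp_increasing. lra. }
    pose proof (exp_pos (- v)). pose proof (exp_pos (- u)).
    replace (pos eps) with ((C + 1) * (eps / (C + 1))) by (field; lra). nra. }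
  exists (fun u => M < u). split.
  - now exists M.
  - intros u v Hu Hv. change (Rabs (RInt f W v - RInt f W u) < eps).
    destruct (Rle_dec u v).
    + now apply key.
    + rewrite Rabs_minus_sym. apply key; lra.
Qed.

Lemma hol_ray_continuous (m phi : R) (A B A' B' : R -> R -> R) :
  holomorphic_strip m A B A' B' -> 0 < phi < m ->
  forall w, continuous (fun w => B w phi) w.
Proof.
  intros hol Hphi w. apply (is_derive_continuous _ _ (B' w phi)).
  apply (hol_B_w _ _ _ _ _ hol). rewrite Rabs_pos_eq; lra.
Qed.

Lemma hol_arc_ex_RInt (m phi : R) (A B A' B' : R -> R -> R) (W : R) :
  holomorphic_strip m A B A' B' -> 0 < phi < m -> ex_RInt (A W) 0 phi.
Proof.
  intros hol Hphi. apply (ex_RInt_continuous (V := R_CompleteNormedModule)). intros t Ht.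
  rewrite Rmin_left in Ht by lra. rewrite Rmax_right in Ht by lra.
  apply (is_derive_continuous _ _ (- B' W t)).
  apply (hol_A_th _ _ _ _ _ hol). rewrite Rabs_pos_eq; lra.
Qed.

(** Domination makes the ray from [w = 0] converge. By [cauchy_rectangle], moving the arc to another
    radius changes it by exactly the piece of ray gained or lost, so one limit serves all [W]. *)
Lemma is_contour_exists (m phi C : R) (A B A' B' : R -> R -> R) :
  holomorphic_strip m A B A' B' -> 0 < phi < m -> (forall w, B w 0 = 0) ->
  (forall w, 0 <= w -> Rabs (B w phi) <= C * exp (- w)) ->
  exists l, is_contour phi A B l.
Proof.
  intros hol Hphi HB0 Hb.
  pose proof (hol_ray_continuous _ _ _ _ _ _ hol Hphi) as Hc.
  destruct (is_lim_RInt_exp_dominated (fun w => B w phi) C 0 Hc Hb) as [l Hl].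
  exists (l + RInt (A 0) 0 phi). intros W.
  apply (is_lim_ext (fun X => RInt (fun w => B w phi) 0 X + RInt (A 0) 0 phi)).
  - intros X. unfold truncated_contour.
    pose proof (cauchy_rectangle m phi A B A' B' 0 W hol Hphi HB0) as H.
    rewrite <- (RInt_split (fun w => B w phi) 0 W X Hc). lra.
  - apply is_lim_plus'; [exact Hl | apply is_lim_const].
Qed.

Lemma is_contour_unique (phi : R) (A B : R -> R -> R) (l1 l2 : R) :
  is_contour phi A B l1 -> is_contour phi A B l2 -> l1 = l2.
Proof.
  intros H1 H2. pose proof (is_lim_unique _ _ _ (H1 0)) as E1.
  pose proof (is_lim_unique _ _ _ (H2 0)) as E2. congruence.
Qed.

(** The ray contributes at most the integral of [M * exp (- w)] over [w >= W], and the arc at most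
    [N]. All later estimates on contour integrals go through this, with [W] chosen to suit. *)
Lemma is_contour_bound (phi : R) (A B : R -> R -> R) (l W M N : R) :
  is_contour phi A B l -> (forall w, continuous (fun w => B w phi) w) ->
  (forall w, W <= w -> Rabs (B w phi) <= M * exp (- w)) ->
  Rabs (RInt (A W) 0 phi) <= N ->
  Rabs l <= M * exp (- W) + N.
Proof.
  intros Hl Hc Hb HN.
  assert (HM : 0 <= M).
  { pose proof (Hb W (Rle_refl W)) as H0. pose proof (Rabs_pos (B W phi)).
    pose proof (exp_pos (- W)). nra. }
  assert (L : is_lim (fun X => Rabs (truncated_contour phi A B W X)) p_infty (Rabs l)).
  { apply (is_lim_Rabs _ _ (Finite l)), Hl. }
  apply (is_lim_le_loc (fun X => Rabs (truncated_contour phi A B W X))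
           (fun _ => M * exp (- W) + N) p_infty (Rabs l) (M * exp (- W) + N));
    [| exact L | apply is_lim_const].
  exists W. intros X HX. unfold truncated_contour.
  eapply Rle_trans; [apply Rabs_triang |]. apply Rplus_le_compat; [| exact HN].
  eapply Rle_trans; [apply (abs_RInt_exp_le _ M W X); try assumption; lra |].
  pose proof (exp_pos (- X)). nra.
Qed.

(** The identity for [A] is asked only on the sector [0 <= th <= phi], where the denominators of the
    later integrands are known not to vanish. *)
Lemma is_contour_combination (m phi x : R) (A1 B1 A1' B1' A2 B2 A2' B2' A B : R -> R -> R) (l1 l2 : R) :
  holomorphic_strip m A1 B1 A1' B1' -> holomorphic_strip m A2 B2 A2' B2' -> 0 < phi < m ->
  is_contour phi A1 B1 l1 -> is_contour phi A2 B2 l2 ->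
  (forall w th, 0 <= th <= phi -> A w th = A1 w th + x * A2 w th) ->
  (forall w, B w phi = B1 w phi + x * B2 w phi) ->
  is_contour phi A B (l1 + x * l2).
Proof.
  intros hol1 hol2 Hphi H1 H2 HA HB W.
  apply (is_lim_ext (fun X => truncated_contour phi A1 B1 W X + x * truncated_contour phi A2 B2 W X)).
  - intros X. unfold truncated_contour.
    assert (ex1 : ex_RInt (fun w => B1 w phi) W X).
    { apply (ex_RInt_continuous (V := R_CompleteNormedModule)).
      intros; apply (hol_ray_continuous _ _ _ _ _ _ hol1 Hphi). }
    assert (ex2 : ex_RInt (fun w => B2 w phi) W X).
    { apply (ex_RInt_continuous (V := R_CompleteNormedModule)).
      intros; apply (hol_ray_continuous _ _ _ _ _ _ hol2 Hphi). }
    pose proof (hol_arc_ex_RInt _ _ _ _ _ _ W hol1 Hphi) as ex3.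
    pose proof (hol_arc_ex_RInt _ _ _ _ _ _ W hol2 Hphi) as ex4.
    assert (EB : RInt (fun w => B w phi) W X
                 = RInt (fun w => B1 w phi) W X + x * RInt (fun w => B2 w phi) W X).
    { apply is_RInt_unique.
      apply (is_RInt_ext (fun w => plus (B1 w phi) (scal x (B2 w phi)))).
      { intros w _. symmetry. apply HB. }
      apply (is_RInt_plus (fun w => B1 w phi)); [| apply (is_RInt_scal (fun w => B2 w phi))];
        now apply (RInt_correct (V := R_CompleteNormedModule)). }
    assert (EA : RInt (A W) 0 phi = RInt (A1 W) 0 phi + x * RInt (A2 W) 0 phi).
    { apply is_RInt_unique.
      apply (is_RInt_ext (fun th => plus (A1 W th) (scal x (A2 W th)))).
      { intros th Hth. rewrite Rmin_left in Hth by lra. rewrite Rmax_right in Hth by lra.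
        symmetry. apply HA. lra. }
      apply (is_RInt_plus (A1 W)); [| apply (is_RInt_scal (A2 W))];
        now apply (RInt_correct (V := R_CompleteNormedModule)). }
    rewrite EA, EB. ring.
  - apply is_lim_plus'; [apply H1 | apply (is_lim_scal_l _ x p_infty (Finite l2)), H2].
Qed.

(** By the fundamental theorem of calculus, ray and arc telescope to [B X phi - B 0 0]; the first
    term decays and the second is zero. This is integration by parts along the contour. *)
Lemma is_contour_derivative (m phi C l : R) (A B A' B' : R -> R -> R) :
  holomorphic_strip m A B A' B' -> 0 < phi < m -> (forall w, B w 0 = 0) ->
  (forall w, 0 <= w -> Rabs (B w phi) <= C * exp (- w)) ->
  is_contour phi A' B' l -> l = 0.
Proof.
  intros hol Hphi HB0 Hb Hl.
  assert (L : is_lim (truncated_contour phi A' B' 0) p_infty 0).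
  { apply (is_lim_ext (fun X => B X phi)).
    - intros X. unfold truncated_contour.
      assert (E1 : RInt (fun w => B' w phi) 0 X = B X phi - B 0 phi).
      { apply is_RInt_unique, (is_RInt_derive (fun w => B w phi)).
        - intros w _. apply (hol_B_w _ _ _ _ _ hol). rewrite Rabs_pos_eq; lra.
        - intros w _. apply continuity_2d_pt_fst, (hol_B'_cont _ _ _ _ _ hol).
          rewrite Rabs_pos_eq; lra. }
      assert (E2 : RInt (A' 0) 0 phi = B 0 phi - B 0 0).
      { apply is_RInt_unique, (is_RInt_derive (B 0)); intros t Ht;
          rewrite Rmin_left in Ht by lra; rewrite Rmax_right in Ht by lra;
          assert (Rabs t < m) by (rewrite Rabs_pos_eq; lra).
        - now apply (hol_B_th _ _ _ _ _ hol).
        - now apply continuity_2d_pt_snd, (hol_A'_cont _ _ _ _ _ hol). }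
      rewrite E1, E2, HB0. ring.
    - assert (Hexp : is_lim (fun X => exp (- X)) p_infty 0).
      { apply (is_lim_comp exp (fun X => - X) p_infty 0 m_infty).
        - apply is_lim_exp_m.
        - apply (is_lim_opp (fun X => X) p_infty p_infty), is_lim_id.
        - exists 0. intros X _. discriminate. }
      apply (is_lim_le_le_loc (fun X => - C * exp (- X)) (fun X => C * exp (- X))).
      + exists 0. intros X HX. pose proof (Hb X (Rlt_le _ _ HX)) as H.
        apply Rabs_le_between in H. lra.
      + replace (Finite 0) with (Rbar_mult (- C) 0) by (simpl; f_equal; ring).
        now apply is_lim_scal_l.
      + replace (Finite 0) with (Rbar_mult C 0) by (simpl; f_equal; ring).
        now apply is_lim_scal_l. }
  pose proof (is_lim_unique _ _ _ (Hl 0)) as E1.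
  pose proof (is_lim_unique _ _ _ L) as E2. congruence.
Qed.

(** * The integrands and their holomorphy *)

Ltac cont2d :=
  repeat first
    [ assumption
    | apply continuity_2d_pt_plus
    | apply continuity_2d_pt_minus
    | apply continuity_2d_pt_mult
    | apply continuity_2d_pt_opp
    | apply continuity_2d_pt_const
    | apply continuity_2d_pt_id1
    | apply continuity_2d_pt_id2
    | apply continuity_2d_pt_inv
    | apply (continuity_1d_2d_pt_comp exp);
        [ apply derivable_continuous_pt, derivable_pt_exp | ]
    | apply (continuity_1d_2d_pt_comp cos); [ apply continuity_cos | ]
    | apply (continuity_1d_2d_pt_comp sin); [ apply continuity_sin | ] ].

(* Real and imaginary parts of exp (exp zeta + a zeta) at zeta = w + i th. *)
Definition PhiA (a w th : R) : R := exp (exp w * cos th + a * w) * cos (exp w * sin th + a * th).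
Definition PhiB (a w th : R) : R := exp (exp w * cos th + a * w) * sin (exp w * sin th + a * th).

(** Real part of the multiplication by [s^b = exp (b zeta)]; [PhiB_add] is the imaginary part. *)
Lemma PhiA_add (a b w th : R) :
  PhiA (a + b) w th = exp (b * w) * (cos (b * th) * PhiA a w th - sin (b * th) * PhiB a w th).
Proof.
  unfold PhiA, PhiB.
  replace (exp w * cos th + (a + b) * w) with (exp w * cos th + a * w + b * w) by ring.
  replace (exp w * sin th + (a + b) * th) with (exp w * sin th + a * th + b * th) by ring.
  rewrite exp_plus, cos_plus. ring.
Qed.

Lemma PhiB_add (a b w th : R) :
  PhiB (a + b) w th = exp (b * w) * (cos (b * th) * PhiB a w th + sin (b * th) * PhiA a w th).
Proof.
  unfold PhiA, PhiB.
  replace (exp w * cos th + (a + b) * w) with (exp w * cos th + a * w + b * w) by ring.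
  replace (exp w * sin th + (a + b) * th) with (exp w * sin th + a * th + b * th) by ring.
  rewrite exp_plus, sin_plus. ring.
Qed.

(** The logarithmic derivative of [exp (exp zeta + a zeta)] is [exp zeta + a], and the factor
    [exp zeta] raises the index [a] by one. *)
Lemma Phi_hol (m a : R) :
  holomorphic_strip m (PhiA a) (PhiB a)
    (fun w th => PhiA (a + 1) w th + a * PhiA a w th)
    (fun w th => PhiB (a + 1) w th + a * PhiB a w th).
Proof.
  assert (HA : forall b w th, continuity_2d_pt (PhiA b) w th).
  { intros b w th. unfold PhiA. cont2d. }
  assert (HB : forall b w th, continuity_2d_pt (PhiB b) w th).
  { intros b w th. unfold PhiB. cont2d. }
  constructor; intros w th _; try apply HA; try apply HB;
    try (apply continuity_2d_pt_plus;
         [apply HA || apply HB | apply continuity_2d_pt_mult;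
                       [apply continuity_2d_pt_const | apply HA || apply HB]]);
    rewrite ?PhiA_add, ?PhiB_add, ?Rmult_1_l; unfold PhiA, PhiB; auto_derive; trivial; ring.
Qed.

Lemma PhiB_real_axis (a w : R) : PhiB a w 0 = 0.
Proof.
  unfold PhiB. rewrite sin_0.
  replace (exp w * 0 + a * 0) with 0 by ring. rewrite sin_0. ring.
Qed.

Lemma PhiB_abs_le (a w th : R) : Rabs (PhiB a w th) <= exp (exp w * cos th + a * w).
Proof.
  unfold PhiB. rewrite Rabs_mult, (Rabs_pos_eq (exp _)) by apply Rlt_le, exp_pos.
  pose proof (exp_pos (exp w * cos th + a * w)).
  pose proof (SIN_bound (exp w * sin th + a * th)).
  assert (Rabs (sin (exp w * sin th + a * th)) <= 1) by (apply Rabs_le; lra). nra.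
Qed.

(** With [F = f + i g] and [G = c + i d], this is the real part of
    [(F / G)' = (F' - (F / G) G') / G]. In this form the derivative is again a quotient by [G], so
    [quotient_hol] can treat its continuity like that of [F / G]. *)
Lemma is_derive_quotient_re (f g c d : R -> R) (f' g' c' d' x : R) :
  is_derive f x f' -> is_derive g x g' -> is_derive c x c' -> is_derive d x d' ->
  c x ^ 2 + d x ^ 2 <> 0 ->
  is_derive (fun y => (f y * c y + g y * d y) / (c y ^ 2 + d y ^ 2)) x
    (let n := c x ^ 2 + d x ^ 2 in
     let p := (f x * c x + g x * d x) / n in
     let q := (g x * c x - f x * d x) / n in
     ((f' - (p * c' - q * d')) * c x + (g' - (p * d' + q * c')) * d x) / n).
Proof.
  intros Hf Hg Hc Hd Hn. auto_derive.
  - repeat split; trivial; eexists; eassumption.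
  - rewrite (is_derive_unique (fun x0 : R => f x0) x f' Hf),
      (is_derive_unique (fun x0 : R => g x0) x g' Hg),
      (is_derive_unique (fun x0 : R => c x0) x c' Hc),
      (is_derive_unique (fun x0 : R => d x0) x d' Hd).
    simpl in *. field; intro E; apply Hn; rewrite <- E; ring.
Qed.

Lemma is_derive_quotient_im (f g c d : R -> R) (f' g' c' d' x : R) :
  is_derive f x f' -> is_derive g x g' -> is_derive c x c' -> is_derive d x d' ->
  c x ^ 2 + d x ^ 2 <> 0 ->
  is_derive (fun y => (g y * c y - f y * d y) / (c y ^ 2 + d y ^ 2)) x
    (let n := c x ^ 2 + d x ^ 2 in
     let p := (f x * c x + g x * d x) / n in
     let q := (g x * c x - f x * d x) / n in
     ((g' - (p * d' + q * c')) * c x - (f' - (p * c' - q * d')) * d x) / n).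
Proof.
  intros Hf Hg Hc Hd Hn. auto_derive.
  - repeat split; trivial; eexists; eassumption.
  - rewrite (is_derive_unique (fun x0 : R => f x0) x f' Hf),
      (is_derive_unique (fun x0 : R => g x0) x g' Hg),
      (is_derive_unique (fun x0 : R => c x0) x c' Hc),
      (is_derive_unique (fun x0 : R => d x0) x d' Hd).
    simpl in *. field; intro E; apply Hn; rewrite <- E; ring.
Qed.

Definition quot_re (A B C D : R -> R -> R) (w th : R) : R :=
  (A w th * C w th + B w th * D w th) / (C w th ^ 2 + D w th ^ 2).
Definition quot_im (A B C D : R -> R -> R) (w th : R) : R :=
  (B w th * C w th - A w th * D w th) / (C w th ^ 2 + D w th ^ 2).

Lemma quotient_hol (m : R) (A B A' B' C D C' D' : R -> R -> R) :
  holomorphic_strip m A B A' B' -> holomorphic_strip m C D C' D' ->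
  (forall w th, Rabs th < m -> C w th ^ 2 + D w th ^ 2 <> 0) ->
  let P := quot_re A B C D in
  let Q := quot_im A B C D in
  let U := fun w th => A' w th - (P w th * C' w th - Q w th * D' w th) in
  let V := fun w th => B' w th - (P w th * D' w th + Q w th * C' w th) in
  holomorphic_strip m P Q (quot_re U V C D) (quot_im U V C D).
Proof.
  intros h1 h2 Hn P Q U V.
  assert (cq : forall A B w th, Rabs th < m -> continuity_2d_pt A w th -> continuity_2d_pt B w th ->
            continuity_2d_pt (quot_re A B C D) w th /\ continuity_2d_pt (quot_im A B C D) w th).
  { intros A0 B0 w th Ht cA cB. specialize (Hn w th Ht).
    pose proof (hol_A_cont _ _ _ _ _ h2 w th Ht) as c3.
    pose proof (hol_B_cont _ _ _ _ _ h2 w th Ht) as c4.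
    unfold quot_re, quot_im, Rdiv. simpl. simpl in Hn.
    split; cont2d. }
  assert (c0 : forall w th, Rabs th < m -> continuity_2d_pt P w th /\ continuity_2d_pt Q w th).
  { intros w th Ht. apply cq; trivial.
    - now apply (hol_A_cont _ _ _ _ _ h1).
    - now apply (hol_B_cont _ _ _ _ _ h1). }
  assert (c1 : forall w th, Rabs th < m -> continuity_2d_pt U w th /\ continuity_2d_pt V w th).
  { intros w th Ht. destruct (c0 w th Ht) as [cP cQ].
    pose proof (hol_A'_cont _ _ _ _ _ h1 w th Ht) as e1.
    pose proof (hol_B'_cont _ _ _ _ _ h1 w th Ht) as e2.
    pose proof (hol_A'_cont _ _ _ _ _ h2 w th Ht) as e3.
    pose proof (hol_B'_cont _ _ _ _ _ h2 w th Ht) as e4.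
    unfold U, V. split; cont2d. }
  constructor; intros w th Ht.
  - exact (is_derive_quotient_re _ _ _ _ _ _ _ _ _
      (hol_A_w _ _ _ _ _ h1 w th Ht) (hol_B_w _ _ _ _ _ h1 w th Ht)
      (hol_A_w _ _ _ _ _ h2 w th Ht) (hol_B_w _ _ _ _ _ h2 w th Ht) (Hn w th Ht)).
  - exact (is_derive_quotient_im _ _ _ _ _ _ _ _ _
      (hol_A_w _ _ _ _ _ h1 w th Ht) (hol_B_w _ _ _ _ _ h1 w th Ht)
      (hol_A_w _ _ _ _ _ h2 w th Ht) (hol_B_w _ _ _ _ _ h2 w th Ht) (Hn w th Ht)).
  (* In the [th] direction all derivatives carry a factor [i]; what remains after the quotient rule
     is the Cauchy-Riemann equation, a rational identity. *)
  - evar_last.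
    exact (is_derive_quotient_re _ _ _ _ _ _ _ _ _
      (hol_A_th _ _ _ _ _ h1 w th Ht) (hol_B_th _ _ _ _ _ h1 w th Ht)
      (hol_A_th _ _ _ _ _ h2 w th Ht) (hol_B_th _ _ _ _ _ h2 w th Ht) (Hn w th Ht)).
    specialize (Hn w th Ht). unfold quot_im, U, V, P, Q, quot_re, quot_im. simpl in *. field; intro E; apply Hn; rewrite <- E; ring.
  - evar_last.
    exact (is_derive_quotient_im _ _ _ _ _ _ _ _ _
      (hol_A_th _ _ _ _ _ h1 w th Ht) (hol_B_th _ _ _ _ _ h1 w th Ht)
      (hol_A_th _ _ _ _ _ h2 w th Ht) (hol_B_th _ _ _ _ _ h2 w th Ht) (Hn w th Ht)).
    specialize (Hn w th Ht). unfold quot_re, U, V, P, Q, quot_re, quot_im. simpl in *. field; intro E; apply Hn; rewrite <- E; ring.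
  - apply c0, Ht.
  - apply c0, Ht.
  - apply cq; trivial; apply c1, Ht.
  - apply cq; trivial; apply c1, Ht.
Qed.

(* Real and imaginary parts of exp (beta zeta) + x at zeta = w + i th. *)
Definition DenA (beta x w th : R) : R := exp (beta * w) * cos (beta * th) + x.
Definition DenB (beta w th : R) : R := exp (beta * w) * sin (beta * th).

Lemma Den_hol (m beta x : R) :
  holomorphic_strip m (DenA beta x) (DenB beta)
    (fun w th => beta * DenA beta 0 w th) (fun w th => beta * DenB beta w th).
Proof.
  assert (HA : forall y w th, continuity_2d_pt (DenA beta y) w th).
  { intros y w th. unfold DenA. cont2d. }
  assert (HB : forall w th, continuity_2d_pt (DenB beta) w th).
  { intros w th. unfold DenB. cont2d. }
  constructor; intros w th _; try apply HA; try apply HB;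
    try (apply continuity_2d_pt_mult; [apply continuity_2d_pt_const | apply HA || apply HB]);
    unfold DenA, DenB; auto_derive; trivial; ring.
Qed.

Lemma Den_norm (beta x w th : R) :
  DenA beta x w th ^ 2 + DenB beta w th ^ 2
  = exp (beta * w) ^ 2 + 2 * x * exp (beta * w) * cos (beta * th) + x ^ 2.
Proof.
  unfold DenA, DenB. pose proof (sin2_cos2 (beta * th)) as H. unfold Rsqr in H.
  transitivity (exp (beta * w) ^ 2 * (sin (beta * th) * sin (beta * th) + cos (beta * th) * cos (beta * th))
     + 2 * x * exp (beta * w) * cos (beta * th) + x ^ 2); [ring | rewrite H; ring].
Qed.

Lemma cos_gt_m1 (y : R) : Rabs y < PI -> -1 < cos y.
Proof.
  intros H. rewrite <- cos_PI.
  assert (E : cos y = cos (Rabs y)).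
  { unfold Rabs. destruct (Rcase_abs y); [now rewrite cos_neg | reflexivity]. }
  rewrite E. apply cos_decreasing_1; pose proof (Rabs_pos y); lra.
Qed.

(** With [E = exp (beta * w)], the squared modulus is [(E - x)^2 + 2 x E (1 + cos (beta * th))], and
    the cosine exceeds -1 because [beta * |th| < PI]. *)
Lemma Den_neq0 (beta x w th : R) :
  0 < beta -> 0 < x -> Rabs th < PI / beta ->
  DenA beta x w th ^ 2 + DenB beta w th ^ 2 <> 0.
Proof.
  intros Hb Hx Ht. rewrite Den_norm.
  assert (H : -1 < cos (beta * th)).
  { apply cos_gt_m1. rewrite Rabs_mult, (Rabs_pos_eq beta) by lra.
    apply Rmult_lt_compat_l with (r := beta) in Ht; trivial.
    replace (beta * (PI / beta)) with PI in Ht by (field; lra). exact Ht. }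
  set (c := cos (beta * th)) in *. pose proof (exp_pos (beta * w)) as HE.
  set (E := exp (beta * w)) in *.
  apply Rgt_not_eq.
  replace (E ^ 2 + 2 * x * E * c + x ^ 2) with ((E - x) ^ 2 + 2 * (x * E) * (c + 1)) by ring.
  pose proof (pow2_ge_0 (E - x)). assert (0 < x * E) by now apply Rmult_lt_0_compat.
  assert (0 < (x * E) * (c + 1)) by (apply Rmult_lt_0_compat; lra). lra.
Qed.

Definition PsiA (beta x a : R) : R -> R -> R := quot_re (PhiA a) (PhiB a) (DenA beta x) (DenB beta).
Definition PsiB (beta x a : R) : R -> R -> R := quot_im (PhiA a) (PhiB a) (DenA beta x) (DenB beta).

Lemma Psi_hol (beta x a : R) :
  0 < beta -> 0 < x ->
  exists A' B', holomorphic_strip (PI / beta) (PsiA beta x a) (PsiB beta x a) A' B'.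
Proof.
  intros Hb Hx. eexists. eexists.
  apply (quotient_hol _ _ _ _ _ _ _ _ _ (Phi_hol _ a) (Den_hol _ beta x)).
  intros w th. now apply Den_neq0.
Qed.

Lemma PsiB_real_axis (beta x a w : R) : PsiB beta x a w 0 = 0.
Proof.
  unfold PsiB, quot_im. rewrite PhiB_real_axis. unfold DenB.
  replace (beta * 0) with 0 by ring. rewrite sin_0. unfold Rdiv. ring.
Qed.

(** Real part of [1 = s^beta / (s^beta + x) + x / (s^beta + x)] multiplied by the integrand
    [Phi]. *)
Lemma PsiA_shift (beta x a w th : R) :
  0 < beta -> 0 < x -> Rabs th < PI / beta ->
  PhiA a w th = PsiA beta x (a + beta) w th + x * PsiA beta x a w th.
Proof.
  intros Hb Hx Ht. pose proof (Den_neq0 beta x w th Hb Hx Ht) as Hn.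
  unfold PsiA, quot_re. rewrite PhiA_add, PhiB_add.
  unfold DenA, DenB in *. simpl in *. field; intro E; apply Hn; rewrite <- E; ring.
Qed.

Lemma PsiB_shift (beta x a w th : R) :
  0 < beta -> 0 < x -> Rabs th < PI / beta ->
  PhiB a w th = PsiB beta x (a + beta) w th + x * PsiB beta x a w th.
Proof.
  intros Hb Hx Ht. pose proof (Den_neq0 beta x w th Hb Hx Ht) as Hn.
  unfold PsiB, quot_im. rewrite PhiA_add, PhiB_add.
  unfold DenA, DenB in *. simpl in *. field; intro E; apply Hn; rewrite <- E; ring.
Qed.

(** * Admissible angles and the integrals [h] and [J_b] *)

(** Beyond [PI / 2] the cosine is negative, so [e^s] decays along the ray. *)
Definition is_hankel_angle (phi : R) : Prop := PI / 2 < phi < PI.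

(* phi < PI / beta keeps the zeros of s^beta + x outside the sector |arg s| <= phi. *)
Definition is_resolvent_angle (beta phi : R) : Prop :=
  1 < beta < 2 /\ PI / 2 < phi < PI / beta.

Lemma resolvent_angle_hankel (beta phi : R) :
  is_resolvent_angle beta phi -> is_hankel_angle phi.
Proof.
  intros [Hb Hphi]. split; [lra |].
  apply Rlt_le_trans with (PI / beta); [lra |].
  apply Rle_div_l; [lra |]. pose proof PI_RGT_0. nra.
Qed.

Lemma cos_hankel_angle (phi : R) : is_hankel_angle phi -> cos phi < 0.
Proof. intros H. unfold is_hankel_angle in H. apply cos_lt_0; lra. Qed.

Lemma exp_monotone (x y : R) : x <= y -> exp x <= exp y.
Proof.
  intros [H | ->]; [left; now apply exp_increasing | right; reflexivity].
Qed.

(** With [k = - cos phi], the inequality [w^2 / 4 <= exp w] reduces the claim to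
    [(a + 1) w <= k w^2 / 4 + (a + 1)^2 / k], a completed square. *)
Lemma ray_decay (phi a w : R) :
  is_hankel_angle phi -> 0 <= w ->
  exp (exp w * cos phi + a * w) <= exp ((a + 1) ^ 2 / - cos phi) * exp (- w).
Proof.
  intros Hphi Hw. apply cos_hankel_angle in Hphi. rewrite <- exp_plus.
  apply exp_monotone.
  set (k := - cos phi). replace (cos phi) with (- k) by (unfold k; ring).
  assert (Hk : 0 < k) by (unfold k; lra).
  assert (He : w ^ 2 / 4 <= exp w).
  { replace w with (w / 2 + w / 2) at 2 by field. rewrite exp_plus.
    pose proof (exp_ineq1_le (w / 2)). nra. }
  assert (Hs : 0 <= k * (w / 2 - (a + 1) / k) ^ 2).
  { apply Rmult_le_pos; [lra | apply pow2_ge_0]. }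
  replace (k * (w / 2 - (a + 1) / k) ^ 2) with (k * (w ^ 2 / 4) - (a + 1) * w + (a + 1) ^ 2 / k)
    in Hs by (field; lra).
  nra.
Qed.

(** [h(z)] of the overview, up to normalisation; the index [1 - z] is the exponent [- z] raised by
    one through [ds = s dzeta]. The choice [W = 0] is immaterial by Cauchy's theorem. *)
Definition hankel (phi z : R) : R :=
  real (Lim (truncated_contour phi (PhiA (1 - z)) (PhiB (1 - z)) 0) p_infty).

(** [J_b(x)] of the overview; again [ds = s dzeta] turns the exponent [beta - b] into
    [1 + beta - b]. *)
Definition resolvent (beta phi x b : R) : R :=
  real (Lim (truncated_contour phi (PsiA beta x (1 + beta - b)) (PsiB beta x (1 + beta - b)) 0) p_infty).

Lemma hankel_correct (phi z : R) :
  is_hankel_angle phi -> is_contour phi (PhiA (1 - z)) (PhiB (1 - z)) (hankel phi z).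
Proof.
  intros Hphi. pose proof PI_RGT_0.
  destruct (is_contour_exists PI phi (exp ((1 - z + 1) ^ 2 / - cos phi)) _ _ _ _ (Phi_hol PI (1 - z)))
    as [l Hl].
  - unfold is_hankel_angle in Hphi. lra.
  - intros w. apply PhiB_real_axis.
  - intros w Hw. eapply Rle_trans; [apply PhiB_abs_le | now apply ray_decay].
  - unfold hankel. rewrite (is_lim_unique _ _ _ (Hl 0)). exact Hl.
Qed.

(** * Pointwise bounds on the resolvent integrand *)

(** Cauchy-Schwarz, for the real part of a quotient of complex numbers. The imaginary part is
    covered by replacing [(a, b)] with [(b, - a)]. *)
Lemma quot_abs_le (a b c d e y : R) :
  a ^ 2 + b ^ 2 = e ^ 2 -> 0 <= e -> 0 < y -> y ^ 2 <= c ^ 2 + d ^ 2 ->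
  Rabs ((a * c + b * d) / (c ^ 2 + d ^ 2)) <= e / y.
Proof.
  intros He He0 Hy Hn.
  assert (Hy2 : 0 < y ^ 2) by nra.
  set (n := c ^ 2 + d ^ 2) in *.
  apply Rsqr_incr_0_var; [| apply Rdiv_le_0_compat; lra].
  rewrite <- Rsqr_abs. unfold Rsqr.
  replace (e / y * (e / y)) with (e ^ 2 / y ^ 2) by (field; lra).
  assert (CS : (a * c + b * d) ^ 2 <= e ^ 2 * n).
  { rewrite <- He. unfold n. pose proof (pow2_ge_0 (a * d - b * c)). nra. }
  replace ((a * c + b * d) / n * ((a * c + b * d) / n)) with ((a * c + b * d) ^ 2 / n ^ 2)
    by (field; lra).
  apply Rle_trans with (e ^ 2 / n).
  - apply Rle_div_l; [nra |]. replace (e ^ 2 / n * n ^ 2) with (e ^ 2 * n) by (field; lra). exact CS.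
  - unfold Rdiv. apply Rmult_le_compat_l; [nra |]. apply Rinv_le_contravar; assumption.
Qed.

Lemma Phi_norm (a w th : R) :
  PhiA a w th ^ 2 + PhiB a w th ^ 2 = exp (exp w * cos th + a * w) ^ 2.
Proof.
  unfold PhiA, PhiB. pose proof (sin2_cos2 (exp w * sin th + a * th)) as H. unfold Rsqr in H.
  set (E := exp (exp w * cos th + a * w)).
  rewrite !Rpow_mult_distr. simpl. rewrite <- Rmult_plus_distr_l, !Rmult_1_r, (Rplus_comm (cos _ * _)), H.
  ring.
Qed.

Definition sector_gap (beta phi : R) : R := 1 + cos (beta * phi).

Lemma sector_gap_bounds (beta phi : R) :
  is_resolvent_angle beta phi -> 0 < sector_gap beta phi <= 1.
Proof.
  intros [Hb Hphi]. unfold sector_gap. pose proof PI_RGT_0.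
  assert (H1 : beta * phi < PI).
  { apply Rlt_le_trans with (beta * (PI / beta)); [apply Rmult_lt_compat_l; lra |].
    right. field. lra. }
  assert (H2 : PI / 2 < beta * phi) by nra.
  split.
  - assert (-1 < cos (beta * phi)); [apply cos_gt_m1; rewrite Rabs_pos_eq; lra | lra].
  - assert (cos (beta * phi) < 0) by (apply cos_lt_0; lra). lra.
Qed.

(** Write [g] for the gap and [E] for [exp (beta * w)]. Since [cos (beta * th) >= g - 1] and
    [2 x E <= x^2 + E^2], the squared modulus is at least [g (x^2 + E^2)], and [g^2 <= g]. Taking
    [y = x] serves the decay in [x], taking [y = exp (beta * w)] the decay in the series index. *)
Lemma Den_ge (beta phi x w th y : R) :
  is_resolvent_angle beta phi -> 0 < x -> 0 <= th <= phi ->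
  y = x \/ y = exp (beta * w) ->
  (sector_gap beta phi * y) ^ 2 <= DenA beta x w th ^ 2 + DenB beta w th ^ 2.
Proof.
  intros Hang Hx Hth Hy. pose proof (sector_gap_bounds _ _ Hang) as Hg.
  destruct Hang as [Hb Hphi]. rewrite Den_norm. pose proof PI_RGT_0.
  assert (H1 : beta * phi < PI).
  { apply Rlt_le_trans with (beta * (PI / beta)); [apply Rmult_lt_compat_l; lra |].
    right. field. lra. }
  assert (Hc : sector_gap beta phi - 1 <= cos (beta * th)).
  { unfold sector_gap.
    assert (cos (beta * phi) <= cos (beta * th)) by (apply cos_decr_1; nra). lra. }
  pose proof (exp_pos (beta * w)) as HE.
  set (E := exp (beta * w)) in *. set (g := sector_gap beta phi) in *.
  set (c := cos (beta * th)) in *.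
  assert (HxE : 0 < x * E) by now apply Rmult_lt_0_compat.
  assert (S1 : 2 * (x * E) * (g - 1) <= 2 * (x * E) * c) by (apply Rmult_le_compat_l; lra).
  assert (S2 : 2 * (x * E) * (1 - g) <= (x ^ 2 + E ^ 2) * (1 - g)).
  { apply Rmult_le_compat_r; [lra |]. pose proof (pow2_ge_0 (x - E)). nra. }
  assert (S3 : (g * y) ^ 2 <= g * y ^ 2).
  { replace ((g * y) ^ 2) with (g * y ^ 2 * g) by ring.
    rewrite <- (Rmult_1_r (g * y ^ 2)) at 2. apply Rmult_le_compat_l; [| lra].
    apply Rmult_le_pos; [lra | apply pow2_ge_0]. }
  assert (S4 : g * y ^ 2 <= g * (x ^ 2 + E ^ 2)).
  { apply Rmult_le_compat_l; [lra |]. pose proof (pow2_ge_0 x). pose proof (pow2_ge_0 E).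
    destruct Hy as [-> | ->]; lra. }
  nra.
Qed.

Lemma PsiA_abs_le (beta phi x a w th y : R) :
  is_resolvent_angle beta phi -> 0 < x -> 0 <= th <= phi ->
  y = x \/ y = exp (beta * w) ->
  Rabs (PsiA beta x a w th) <= exp (exp w * cos th + a * w) / (sector_gap beta phi * y).
Proof.
  intros Hang Hx Hth Hy. apply quot_abs_le.
  - apply Phi_norm.
  - apply Rlt_le, exp_pos.
  - apply Rmult_lt_0_compat; [apply (sector_gap_bounds _ _ Hang) |].
    destruct Hy as [-> | ->]; [assumption | apply exp_pos].
  - now apply Den_ge.
Qed.

Lemma PsiB_abs_le (beta phi x a w th y : R) :
  is_resolvent_angle beta phi -> 0 < x -> 0 <= th <= phi ->
  y = x \/ y = exp (beta * w) ->
  Rabs (PsiB beta x a w th) <= exp (exp w * cos th + a * w) / (sector_gap beta phi * y).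
Proof.
  intros Hang Hx Hth Hy. unfold PsiB, quot_im.
  replace (PhiB a w th * DenA beta x w th - PhiA a w th * DenB beta w th)
    with (PhiB a w th * DenA beta x w th + - PhiA a w th * DenB beta w th) by ring.
  apply quot_abs_le.
  - rewrite <- Phi_norm. ring.
  - apply Rlt_le, exp_pos.
  - apply Rmult_lt_0_compat; [apply (sector_gap_bounds _ _ Hang) |].
    destruct Hy as [-> | ->]; [assumption | apply exp_pos].
  - now apply Den_ge.
Qed.

Lemma PsiB_ray_decay (beta phi x a w : R) :
  is_resolvent_angle beta phi -> 0 < x -> 0 <= w ->
  Rabs (PsiB beta x a w phi)
  <= exp ((a + 1) ^ 2 / - cos phi) / (sector_gap beta phi * x) * exp (- w).
Proof.
  intros Hang Hx Hw.
  pose proof (sector_gap_bounds _ _ Hang) as Hg. pose proof PI_RGT_0.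
  eapply Rle_trans; [apply (PsiB_abs_le beta phi x a w phi x); auto |].
  { destruct Hang; lra. }
  apply Rle_div_l; [apply Rmult_lt_0_compat; lra |].
  eapply Rle_trans; [now apply (ray_decay phi a w (resolvent_angle_hankel _ _ Hang)) |].
  right. field. lra.
Qed.

Lemma resolvent_correct (beta phi x b : R) :
  is_resolvent_angle beta phi -> 0 < x ->
  is_contour phi (PsiA beta x (1 + beta - b)) (PsiB beta x (1 + beta - b)) (resolvent beta phi x b).
Proof.
  intros Hang Hx. pose proof PI_RGT_0. set (a := 1 + beta - b).
  destruct (Psi_hol beta x a) as [A' [B' hol]]; [destruct Hang; lra | assumption |].
  destruct (is_contour_exists _ phi (exp ((a + 1) ^ 2 / - cos phi) / (sector_gap beta phi * x))
              _ _ _ _ hol) as [l Hl].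
  - destruct Hang; lra.
  - intros w. apply PsiB_real_axis.
  - intros w Hw. now apply PsiB_ray_decay.
  - unfold resolvent. fold a. rewrite (is_lim_unique _ _ _ (Hl 0)). exact Hl.
Qed.

(** * Functional equations of [h] and [J_b] *)

Lemma hankel_resolvent (beta phi x b : R) :
  is_resolvent_angle beta phi -> 0 < x ->
  hankel phi b = resolvent beta phi x b + x * resolvent beta phi x (b + beta).
Proof.
  intros Hang Hx. pose proof PI_RGT_0.
  destruct Hang as [Hb Hphi] eqn:E; clear E.
  apply (is_contour_unique phi (PhiA (1 - b)) (PhiB (1 - b))).
  - now apply hankel_correct, (resolvent_angle_hankel beta).
  - destruct (Psi_hol beta x (1 + beta - b)) as [A1 [B1 h1]]; [lra | assumption |].
    destruct (Psi_hol beta x (1 + beta - (b + beta))) as [A2 [B2 h2]]; [lra | assumption |].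
    assert (E1 : 1 + beta - b = 1 - b + beta) by ring.
    assert (E2 : 1 + beta - (b + beta) = 1 - b) by ring.
    apply (is_contour_combination (PI / beta) phi x _ _ _ _ _ _ _ _ _ _ _ _ h1 h2).
    + lra.
    + now apply resolvent_correct.
    + now apply resolvent_correct.
    + intros w th Hth. rewrite E1, E2. apply PsiA_shift; [lra | lra |].
      rewrite Rabs_pos_eq; lra.
    + intros w. rewrite E1, E2. apply PsiB_shift; [lra | lra |].
      rewrite Rabs_pos_eq; lra.
Qed.

(** [h(z) - z h(z + 1)] is the contour integral of the derivative of [e^s s^(-z)], so it
    vanishes. *)
Lemma hankel_succ (phi z : R) :
  is_hankel_angle phi -> hankel phi z = z * hankel phi (z + 1).
Proof.
  intros Hang. pose proof PI_RGT_0.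
  assert (Hphi : 0 < phi < PI) by (unfold is_hankel_angle in Hang; lra).
  assert (E : hankel phi z + - z * hankel phi (z + 1) = 0); [| lra].
  apply (is_contour_derivative PI phi (exp ((- z + 1) ^ 2 / - cos phi)) _ _ _ _ _ (Phi_hol PI (- z)));
    trivial.
  - intros w. apply PhiB_real_axis.
  - intros w Hw. eapply Rle_trans; [apply PhiB_abs_le | now apply ray_decay].
  - apply (is_contour_combination PI phi (- z) _ _ _ _ _ _ _ _ _ _ _ _
             (Phi_hol PI (1 - z)) (Phi_hol PI (1 - (z + 1))) Hphi).
    + now apply hankel_correct.
    + now apply hankel_correct.
    + intros w th _. now replace (1 - (z + 1)) with (- z) by ring; replace (- z + 1) with (1 - z) by ring.
    + intros w. now replace (1 - (z + 1)) with (- z) by ring; replace (- z + 1) with (1 - z) by ring.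
Qed.

(** * Bounds on [J_b(x)] and its expansion in powers of [x] *)

Lemma Psi_ray_continuous (beta phi x a : R) :
  is_resolvent_angle beta phi -> 0 < x ->
  forall w, continuous (fun w => PsiB beta x a w phi) w.
Proof.
  intros [Hb Hphi] Hx. pose proof PI_RGT_0.
  destruct (Psi_hol beta x a) as [A' [B' hol]]; [lra | assumption |].
  apply (hol_ray_continuous _ _ _ _ _ _ hol). lra.
Qed.

Lemma Psi_arc_abs_le (beta phi x a W M : R) :
  is_resolvent_angle beta phi -> 0 < x ->
  (forall th, 0 <= th <= phi -> Rabs (PsiA beta x a W th) <= M) ->
  Rabs (RInt (PsiA beta x a W) 0 phi) <= phi * M.
Proof.
  intros [Hb Hphi] Hx HM. pose proof PI_RGT_0.
  destruct (Psi_hol beta x a) as [A' [B' hol]]; [lra | assumption |].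
  replace (phi * M) with ((phi - 0) * M) by ring.
  apply abs_RInt_le_const; [lra | | exact HM].
  apply (hol_arc_ex_RInt _ _ _ _ _ _ W hol). lra.
Qed.

Lemma exp_pow_INR (x : R) (n : nat) : exp x ^ n = exp (INR n * x).
Proof.
  induction n as [| n IH].
  - simpl. now rewrite Rmult_0_l, exp_0.
  - rewrite S_INR. simpl pow. rewrite IH, <- exp_plus. f_equal. ring.
Qed.

Lemma exp_mul_cos_le (W th : R) : exp W * cos th <= exp W.
Proof. pose proof (exp_pos W). pose proof (COS_bound th). nra. Qed.

(** The arc is taken on the unit circle ([W = 0]) and the denominator is bounded below by
    [sector_gap beta phi * x], on ray and arc alike. *)
Lemma resolvent_abs_le_inv (beta phi b : R) :
  is_resolvent_angle beta phi ->
  exists C, 0 < C /\ forall x, 0 < x -> Rabs (resolvent beta phi x b) <= C / x.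
Proof.
  intros Hang. pose proof (sector_gap_bounds _ _ Hang) as Hg.
  pose proof PI_RGT_0. assert (Hphi : 0 < phi) by (destruct Hang; lra).
  set (a := 1 + beta - b).
  exists ((exp ((a + 1) ^ 2 / - cos phi) + phi * exp 1) / sector_gap beta phi). split.
  { pose proof (exp_pos ((a + 1) ^ 2 / - cos phi)). pose proof (exp_pos 1).
    apply Rdiv_lt_0_compat; nra. }
  intros x Hx.
  replace ((exp ((a + 1) ^ 2 / - cos phi) + phi * exp 1) / sector_gap beta phi / x)
    with (exp ((a + 1) ^ 2 / - cos phi) / (sector_gap beta phi * x) * exp (- 0)
          + phi * (exp 1 / (sector_gap beta phi * x)))
    by (rewrite Ropp_0, exp_0; field; lra).
  apply (is_contour_bound phi _ _ _ 0 _ _ (resolvent_correct beta phi x b Hang Hx)).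
  - now apply Psi_ray_continuous.
  - intros w Hw. now apply PsiB_ray_decay.
  - apply Psi_arc_abs_le; trivial. intros th Hth.
    eapply Rle_trans; [apply (PsiA_abs_le beta phi x _ 0 th x); auto |].
    apply Rmult_le_compat_r.
    { apply Rlt_le, Rinv_0_lt_compat, Rmult_lt_0_compat; lra. }
    apply exp_monotone. pose proof (exp_mul_cos_le 0 th). rewrite exp_0 in *. lra.
Qed.

(** Bounding the denominator below by a multiple of [|s|^beta] leaves [|s|^(1 - b)] times
    [|s|^(- beta n)], and the last factor is at most [exp (- (beta * W)) ^ n] outside the disc of
    radius [exp W]. The constant does not depend on [n]. *)
Lemma resolvent_geometric_bound (beta phi x b W : R) :
  is_resolvent_angle beta phi -> 0 < x -> 0 <= W ->
  exists C, forall n : nat,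
    Rabs (resolvent beta phi x (b + beta * INR n)) <= C * exp (- (beta * W)) ^ n.
Proof.
  intros Hang Hx HW. pose proof (sector_gap_bounds _ _ Hang) as Hg.
  pose proof PI_RGT_0. assert (Hphi : 0 < phi) by (destruct Hang; lra).
  assert (Hb : 1 < beta) by (destruct Hang; lra).
  set (g := sector_gap beta phi) in *.
  set (C1 := exp ((1 - b + 1) ^ 2 / - cos phi)).
  exists (C1 / g * exp (- W) + phi * (exp (exp W + (1 - b) * W) / g)). intros n.
  set (q := exp (- (beta * W)) ^ n).
  assert (Hq : q = exp (- (beta * INR n * W))).
  { unfold q. rewrite exp_pow_INR. f_equal. ring. }
  assert (Hexp : forall w th, exp (exp w * cos th + (1 + beta - (b + beta * INR n)) * w)
                   / (g * exp (beta * w))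
                 = exp (exp w * cos th + (1 - b) * w) * exp (- (beta * INR n * w)) / g).
  { intros w th.
    replace (exp w * cos th + (1 + beta - (b + beta * INR n)) * w)
      with ((exp w * cos th + (1 - b) * w) + - (beta * INR n * w) + beta * w) by ring.
    rewrite 2!exp_plus. field. split; [lra | apply Rgt_not_eq, exp_pos]. }
  replace ((C1 / g * exp (- W) + phi * (exp (exp W + (1 - b) * W) / g)) * q)
    with ((C1 / g * q) * exp (- W) + phi * (exp (exp W + (1 - b) * W) * q / g)) by (field; lra).
  apply (is_contour_bound phi _ _ _ W _ _ (resolvent_correct beta phi x _ Hang Hx)).
  - now apply Psi_ray_continuous.
  - intros w Hw.
    eapply Rle_trans; [apply (PsiB_abs_le beta phi x _ w phi (exp (beta * w))); auto; lra |].
    fold g. rewrite Hexp.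
    replace (C1 / g * q * exp (- w)) with (C1 * exp (- w) * q / g) by (field; lra).
    apply Rmult_le_compat_r; [apply Rlt_le, Rinv_0_lt_compat; lra |].
    apply Rmult_le_compat; try (apply Rlt_le, exp_pos).
    + apply ray_decay; [now apply (resolvent_angle_hankel beta) | lra].
    + rewrite Hq. apply exp_monotone. pose proof (pos_INR n).
      assert (0 <= beta * INR n) by nra. nra.
  - apply Psi_arc_abs_le; trivial. intros th Hth.
    eapply Rle_trans; [apply (PsiA_abs_le beta phi x _ W th (exp (beta * W))); auto |].
    fold g. rewrite Hexp, <- Hq.
    apply Rmult_le_compat_r; [apply Rlt_le, Rinv_0_lt_compat; lra |].
    apply Rmult_le_compat_r; [rewrite Hq; apply Rlt_le, exp_pos |].
    apply exp_monotone. pose proof (exp_mul_cos_le W th). lra.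
Qed.

Lemma resolvent_partial_sum (beta phi x b : R) (n : nat) :
  is_resolvent_angle beta phi -> 0 < x ->
  sum_n (fun k => hankel phi (b + beta * INR k) * (- x) ^ k) n
  = resolvent beta phi x b - (- x) ^ S n * resolvent beta phi x (b + beta * INR (S n)).
Proof.
  intros Hang Hx. induction n as [| n IH].
  - rewrite sum_O. rewrite (hankel_resolvent beta phi x _ Hang Hx). simpl.
    replace (b + beta * 0) with b by ring. replace (b + beta * 1) with (b + beta) by ring. ring.
  - rewrite sum_Sn, IH. change plus with Rplus.
    rewrite (hankel_resolvent beta phi x (b + beta * INR (S n)) Hang Hx).
    replace (b + beta * INR (S n) + beta) with (b + beta * INR (S (S n)))
      by (rewrite (S_INR (S n)); ring).
    simpl pow. lazymatch goal with |- ?l = ?r => change (@eq R l r) end. ring.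
Qed.

Lemma is_series_resolvent (beta phi x b : R) :
  is_resolvent_angle beta phi -> 0 < x ->
  is_series (fun k => hankel phi (b + beta * INR k) * (- x) ^ k) (resolvent beta phi x b).
Proof.
  intros Hang Hx. assert (Hb : 1 < beta) by (destruct Hang; lra).
  (* The radius satisfies [R^beta = 2 x + 1]: at least 1, so that [0 <= W], and above [x], so that
     the remainder is geometric with ratio [x / (2 x + 1) < 1]. *)
  set (W := ln (2 * x + 1) / beta).
  assert (HW : 0 <= W).
  { apply Rdiv_le_0_compat; [| lra]. rewrite <- ln_1. apply Rlt_le, ln_increasing; lra. }
  assert (EW : exp (- (beta * W)) = / (2 * x + 1)).
  { unfold W. replace (beta * (ln (2 * x + 1) / beta)) with (ln (2 * x + 1)) by (field; lra).
    rewrite exp_Ropp, exp_ln; [reflexivity | lra]. }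
  destruct (resolvent_geometric_bound beta phi x b W Hang Hx HW) as [C HC].
  assert (L : is_lim_seq (fun n => (- x) ^ n * resolvent beta phi x (b + beta * INR n)) 0).
  { apply is_lim_seq_abs_0.
    apply (is_lim_seq_le_le (fun _ => 0) _ (fun n => C * (x / (2 * x + 1)) ^ n)).
    - intros n. split; [apply Rabs_pos |].
      rewrite Rabs_mult, <- RPow_abs, Rabs_Ropp, (Rabs_pos_eq x) by lra.
      unfold Rdiv. rewrite Rpow_mult_distr, <- EW.
      pose proof (HC n). assert (0 <= x ^ n) by (apply pow_le; lra). nra.
    - apply is_lim_seq_const.
    - replace (Finite 0) with (Rbar_mult C 0) by (simpl; f_equal; ring).
      apply is_lim_seq_scal_l, is_lim_seq_geom.
      rewrite Rabs_pos_eq by (apply Rdiv_le_0_compat; lra).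
      apply Rlt_div_l; lra. }
  change (is_lim_seq (sum_n (fun k => hankel phi (b + beta * INR k) * (- x) ^ k))
            (resolvent beta phi x b)).
  apply (is_lim_seq_ext
    (fun n => resolvent beta phi x b - (- x) ^ S n * resolvent beta phi x (b + beta * INR (S n)))).
  - intros n. symmetry. now apply resolvent_partial_sum.
  - replace (Finite (resolvent beta phi x b)) with (Finite (resolvent beta phi x b - 0))
      by (f_equal; ring).
    apply is_lim_seq_minus'; [apply is_lim_seq_const |].
    apply (is_lim_seq_incr_1 (fun n => (- x) ^ n * resolvent beta phi x (b + beta * INR n))), L.
Qed.

(** * Positivity of [h(1)] *)

(** By the double-angle formula [1 - cos (2 z) = 2 (sin z)^2], together with [|sin z| <= z] for
    [z >= 0]. *)
Lemma one_sub_cos_le (y : R) : 1 - cos y <= y ^ 2 / 2.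
Proof.
  assert (H : forall z, 0 <= z -> 1 - cos (2 * z) <= (2 * z) ^ 2 / 2).
  { intros z Hz. rewrite cos_2a_sin.
    assert (Rabs (sin z) <= z).
    { destruct Hz as [Hz | <-]; [| rewrite sin_0, Rabs_R0; lra].
      pose proof (sin_lt_x z Hz).
      apply Rabs_le. split; [| lra].
      destruct (Rle_dec z 1).
      - pose proof (sin_gt_0 z Hz). pose proof PI2_1. lra.
      - pose proof (SIN_bound z). lra. }
    assert (sin z ^ 2 <= z ^ 2).
    { rewrite <- (pow2_abs (sin z)). apply pow_incr. split; [apply Rabs_pos | assumption]. }
    nra. }
  destruct (Rle_dec 0 y) as [Hy | Hy].
  - replace y with (2 * (y / 2)) by field. apply H. lra.
  - rewrite <- cos_neg. replace (- y) with (2 * (- y / 2)) by field.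
    replace (y ^ 2) with ((2 * (- y / 2)) ^ 2) by field. apply H. lra.
Qed.

(* The ray integrand is exp (y cos phi) sin (y sin phi) with y = exp w; integrating sin to 1 - cos >= 0
   leaves only a boundary term, because exp (y cos phi) / y decreases. *)
Lemma ray_integral_ge (phi W X : R) :
  is_hankel_angle phi -> W <= X ->
  - (exp W / 2) <= RInt (fun w => PhiB 0 w phi) W X.
Proof.
  intros Hphi HWX. pose proof (cos_hankel_angle _ Hphi) as Hc.
  assert (Hs : 0 < sin phi) by (unfold is_hankel_angle in Hphi; apply sin_gt_0; pose proof PI_RGT_0; lra).
  set (c := cos phi) in *. set (s := sin phi) in *.
  set (psi := fun w => exp (c * exp w) * (1 - cos (s * exp w)) / (s * exp w)).
  set (dpsi := fun w => exp (c * exp w) * sin (s * exp w)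
                 + (exp (c * exp w) * (1 - cos (s * exp w)) / (s * exp w)) * (c * exp w - 1)).
  assert (Hd : forall w, is_derive psi w (dpsi w)).
  { intros w. pose proof (exp_pos w). unfold psi, dpsi. auto_derive.
    - apply Rgt_not_eq, Rmult_lt_0_compat; assumption.
    - field. split; lra. }
  assert (Hdc : forall w, continuous dpsi w).
  { intros w. pose proof (exp_pos w).
    apply (ex_derive_continuous (K := R_AbsRing) (V := R_NormedModule)).
    unfold dpsi. auto_derive. apply Rgt_not_eq, Rmult_lt_0_compat; assumption. }
  assert (Hpos : forall w, 0 <= psi w).
  { intros w. pose proof (exp_pos w). pose proof (exp_pos (c * exp w)).
    pose proof (COS_bound (s * exp w)). unfold psi.
    apply Rdiv_le_0_compat; [apply Rmult_le_pos; lra | apply Rmult_lt_0_compat; assumption]. }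
  assert (I : is_RInt dpsi W X (minus (psi X) (psi W))).
  { apply (is_RInt_derive psi); intros; [apply Hd | apply Hdc]. }
  assert (Hpsi : psi W <= exp W / 2).
  { unfold psi. pose proof (exp_pos W).
    assert (He : exp (c * exp W) <= 1).
    { rewrite <- exp_0. apply exp_monotone. nra. }
    pose proof (one_sub_cos_le (s * exp W)). pose proof (COS_bound (s * exp W)).
    assert (s <= 1) by (unfold s; pose proof (SIN_bound phi); lra).
    apply Rle_div_l; [apply Rmult_lt_0_compat; assumption |].
    apply Rle_trans with (1 * ((s * exp W) ^ 2 / 2)).
    - apply Rmult_le_compat; try lra. apply Rlt_le, exp_pos.
    - replace (1 * ((s * exp W) ^ 2 / 2)) with (exp W / 2 * (s * exp W) * s) by field.
      rewrite <- (Rmult_1_r (exp W / 2 * (s * exp W))) at 2.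
      apply Rmult_le_compat_l; [| assumption].
      apply Rmult_le_pos; [lra |]. apply Rlt_le, Rmult_lt_0_compat; assumption. }
  apply Rle_trans with (psi X - psi W); [specialize (Hpos X); lra |].
  change (psi X - psi W) with (minus (psi X) (psi W)).
  rewrite <- (is_RInt_unique (V := R_CompleteNormedModule) _ _ _ _ I).
  apply RInt_le; trivial.
  - eexists. exact I.
  - apply (ex_RInt_continuous (V := R_CompleteNormedModule)). intros w _.
    apply (hol_ray_continuous _ _ _ _ _ _ (Phi_hol PI 0)).
    unfold is_hankel_angle in Hphi. pose proof PI_RGT_0. lra.
  - intros w _. unfold dpsi, PhiB. fold c s. rewrite !Rmult_0_l, !Rplus_0_r.
    rewrite (Rmult_comm (exp w) c), (Rmult_comm (exp w) s).
    specialize (Hpos w). unfold psi in Hpos. pose proof (exp_pos w).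
    assert (c * exp w - 1 <= 0) by nra. nra.
Qed.

(** On the circle of radius 1/4 the arc integrand is at least 1/2, so the arc contributes at least
    [phi / 2 > 3 / 4], while by [ray_integral_ge] the ray takes away at most 1/8. *)
Lemma hankel_1_pos (phi : R) : is_hankel_angle phi -> 0 < hankel phi 1.
Proof.
  intros Hphi. pose proof (hankel_correct phi 1 Hphi) as Hl.
  replace (1 - 1) with 0 in Hl by ring.
  assert (H3 : 3 / 2 < phi) by (unfold is_hankel_angle in Hphi; pose proof PI2_3_2; lra).
  set (W := ln (1 / 4)). assert (EW : exp W = 1 / 4) by (apply exp_ln; lra).
  assert (Harc : phi * (1 / 2) <= RInt (PhiA 0 W) 0 phi).
  { replace (phi * (1 / 2)) with (RInt (fun _ => 1 / 2) 0 phi)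
      by (rewrite RInt_const; unfold scal; simpl; unfold mult; simpl; ring).
    apply RInt_le; [lra | apply ex_RInt_const | |].
    - apply (hol_arc_ex_RInt _ _ _ _ _ _ W (Phi_hol PI 0)).
      unfold is_hankel_angle in Hphi. lra.
    - intros th _. unfold PhiA. rewrite EW, !Rmult_0_l, !Rplus_0_r.
      pose proof (COS_bound th). pose proof (SIN_bound th).
      pose proof (exp_ineq1_le (1 / 4 * cos th)).
      pose proof (one_sub_cos_le (1 / 4 * sin th)).
      assert (sin th ^ 2 <= 1) by nra.
      assert (3 / 4 <= exp (1 / 4 * cos th)) by lra.
      assert (3 / 4 <= cos (1 / 4 * sin th)) by nra.
      nra. }
  apply Rlt_le_trans with (- (exp W / 2) + phi * (1 / 2)); [rewrite EW; lra |].
  apply (is_lim_le_loc (fun _ => - (exp W / 2) + phi * (1 / 2))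
           (truncated_contour phi (PhiA 0) (PhiB 0) W) p_infty (- (exp W / 2) + phi * (1 / 2))
           (hankel phi 1)); [| apply is_lim_const | apply Hl].
  exists W. intros X HX. apply Rplus_le_compat; [| exact Harc].
  apply ray_integral_ge; [assumption | lra].
Qed.

(** * An upper bound of Stirling type for the factorial *)

(** The difference vanishes at 0 and has derivative [t^2 / ((1 + t) (2 + t)^2) >= 0]. At [y = 1 / n]
    the bound reads [1 <= (n + 1/2) ln (1 + 1 / n)]. *)
Lemma ln_1p_ge (y : R) : 0 <= y -> 2 * y / (2 + y) <= ln (1 + y).
Proof.
  intros Hy.
  assert (Hd : forall t, 0 <= t -> is_derive (fun t => ln (1 + t) - 2 * t / (2 + t)) t
                                     (t ^ 2 / ((1 + t) * (2 + t) ^ 2))).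
  { intros t Ht. auto_derive; [lra | field; lra]. }
  destruct (MVT_gen (fun t => ln (1 + t) - 2 * t / (2 + t)) 0 y
              (fun t => t ^ 2 / ((1 + t) * (2 + t) ^ 2))) as [c [Hc E]].
  - intros t Ht. rewrite Rmin_left in Ht by lra. apply Hd. lra.
  - intros t Ht. rewrite Rmin_left in Ht by lra.
    apply continuity_pt_filterlim, (is_derive_continuous _ _ _ (Hd t (proj1 Ht))).
  - rewrite Rmin_left in Hc by lra. rewrite Rplus_0_r, ln_1 in E.
    assert (0 <= c ^ 2 / ((1 + c) * (2 + c) ^ 2)).
    { apply Rdiv_le_0_compat; [apply pow2_ge_0 |]. apply Rmult_lt_0_compat; nra. }
    assert (0 <= c ^ 2 / ((1 + c) * (2 + c) ^ 2) * (y - 0)) by (apply Rmult_le_pos; lra).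
    lra.
Qed.

(** This is [e <= (1 + 1 / n)^(n + 1/2)], with the half power written as a ratio of square roots and
    cleared. *)
Lemma exp_1_le_pow (n : nat) :
  (1 <= n)%nat -> exp 1 * sqrt (INR n) <= (1 + / INR n) ^ n * sqrt (INR (S n)).
Proof.
  intros Hn. assert (HN : 1 <= INR n) by (apply (le_INR 1); exact Hn).
  set (N := INR n) in *. assert (HNi : 0 < / N) by (apply Rinv_0_lt_compat; lra).
  assert (E1 : (1 + / N) ^ n = exp (N * ln (1 + / N))).
  { unfold N. rewrite <- exp_pow_INR, exp_ln; [reflexivity | fold N; lra]. }
  assert (E2 : sqrt (INR (S n)) = sqrt N * exp (/ 2 * ln (1 + / N))).
  { rewrite S_INR. fold N. replace (N + 1) with (N * (1 + / N)) by (field; lra).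
    rewrite sqrt_mult by lra. f_equal.
    rewrite <- Rpower_sqrt by lra. reflexivity. }
  rewrite E1, E2.
  replace (exp (N * ln (1 + / N)) * (sqrt N * exp (/ 2 * ln (1 + / N))))
    with (exp (N * ln (1 + / N) + / 2 * ln (1 + / N)) * sqrt N) by (rewrite exp_plus; ring).
  apply Rmult_le_compat_r; [apply sqrt_pos |]. apply exp_monotone.
  pose proof (ln_1p_ge (/ N) (Rlt_le _ _ HNi)) as H.
  replace (2 * / N / (2 + / N)) with (/ (N + / 2)) in H by (field; lra).
  rewrite <- Rmult_plus_distr_r.
  apply Rmult_le_compat_l with (r := N + / 2) in H; [| lra].
  rewrite Rinv_r in H by lra. exact H.
Qed.

(** Equality holds at [n = 1], and [exp_1_le_pow] is the induction step. The growth [sqrt n] is what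
    matters: set against the [1 / n] of [hankel_shift_bound], it leaves [1 / sqrt n]. *)
Lemma fact_stirling_le (n : nat) :
  (1 <= n)%nat -> INR (fact n) * exp (INR n) <= exp 1 * sqrt (INR n) * INR n ^ n.
Proof.
  induction n as [| n IH]; [lia |]. intros _.
  destruct n as [| n].
  - simpl. rewrite sqrt_1. lra.
  - assert (Hn : (1 <= S n)%nat) by lia. specialize (IH Hn).
    pose proof (exp_1_le_pow (S n) Hn) as H. set (m := S n) in *.
    assert (HN : 1 <= INR m) by (apply (le_INR 1); exact Hn).
    replace (INR (fact (S m))) with (INR (S m) * INR (fact m))
      by (rewrite <- mult_INR; reflexivity).
    assert (EN : INR (S m) ^ S m = INR (S m) * ((1 + / INR m) ^ m * INR m ^ m)).
    { rewrite <- Rpow_mult_distr. replace ((1 + / INR m) * INR m) with (INR (S m))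
        by (rewrite S_INR; field; lra). reflexivity. }
    rewrite EN. rewrite (S_INR m) at 2. rewrite exp_plus.
    assert (HS : 0 < INR (S m)) by (rewrite S_INR; lra).
    replace (INR (S m) * INR (fact m) * (exp (INR m) * exp 1))
      with (INR (S m) * exp 1 * (INR (fact m) * exp (INR m))) by ring.
    replace (exp 1 * sqrt (INR (S m)) * (INR (S m) * ((1 + / INR m) ^ m * INR m ^ m)))
      with (INR (S m) * exp 1 * (((1 + / INR m) ^ m * sqrt (INR (S m))) * INR m ^ m)) by ring.
    pose proof (exp_pos 1).
    apply Rmult_le_compat_l; [nra |].
    eapply Rle_trans; [exact IH |].
    apply Rmult_le_compat_r; [apply pow_le; lra | exact H].
Qed.

(** * Saddle-point estimate and Gauss's limit for Gamma *)

Lemma cos_lipschitz (x y : R) : Rabs (cos x - cos y) <= Rabs (x - y).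
Proof.
  destruct (MVT_gen cos y x (fun t => - sin t)) as [c [_ E]].
  - intros t _. auto_derive; [trivial | ring].
  - intros t _. apply continuity_cos.
  - rewrite E, Rabs_mult, Rabs_Ropp. pose proof (SIN_bound c).
    assert (Rabs (sin c) <= 1) by (apply Rabs_le; lra).
    pose proof (Rabs_pos (x - y)). nra.
Qed.

(** Halving the angle, [sin th = 2 sin (th / 2) cos (th / 2)]; the mean value theorem gives
    [sin (th / 2) >= (th / 2) cos (th / 2)], and both cosines are at least [cos (phi / 2) > 0]. *)
Lemma sin_ge_linear (phi th : R) :
  is_hankel_angle phi -> 0 <= th <= phi -> cos (phi / 2) ^ 2 * th <= sin th.
Proof.
  intros Hphi Hth. unfold is_hankel_angle in Hphi. pose proof PI_RGT_0.
  replace th with (2 * (th / 2)) at 2 by field. rewrite sin_2a.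
  assert (Hc : cos (phi / 2) <= cos (th / 2)) by (apply cos_decr_1; lra).
  assert (Hc0 : 0 < cos (phi / 2)) by (apply cos_gt_0; lra).
  assert (Hs : th / 2 * cos (th / 2) <= sin (th / 2)).
  { destruct (MVT_gen sin 0 (th / 2) cos) as [c [Hc1 E]].
    - intros t _. auto_derive; [trivial | ring].
    - intros t _. apply continuity_sin.
    - rewrite Rmin_left, Rmax_right in Hc1 by lra. rewrite sin_0 in E.
      assert (cos (th / 2) <= cos c) by (apply cos_decr_1; lra). nra. }
  assert (th / 2 * cos (phi / 2) <= sin (th / 2)) by nra.
  assert (0 <= th / 2 * cos (phi / 2)) by nra. nra.
Qed.

(* Saddle-point estimate on the contour of radius n, where the factor (s / n)^(-z) is close to 1. *)
Lemma hankel_shift_bound (phi z : R) :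
  is_hankel_angle phi -> 0 < z ->
  exists C, 0 < C /\ forall n : nat, (1 <= n)%nat ->
    Rabs (hankel phi (INR n + 1) - Rpower (INR n) z * hankel phi (z + INR n + 1))
    <= C * exp (INR n) / (INR n * INR n ^ n).
Proof.
  intros Hang Hz. pose proof PI_RGT_0.
  pose proof (cos_hankel_angle _ Hang) as Hcos.
  assert (Hphi : 0 < phi < PI) by (unfold is_hankel_angle in Hang; lra).
  set (kap := cos (phi / 2) ^ 2).
  assert (Hkap : 0 < kap).
  { unfold kap. apply pow_lt, cos_gt_0; lra. }
  exists (2 / - cos phi + z / kap). split.
  { apply Rplus_lt_0_compat; apply Rdiv_lt_0_compat; lra. }
  intros n Hn. assert (HN : 1 <= INR n) by (apply (le_INR 1); exact Hn).
  set (N := INR n) in *. set (W := ln N).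
  assert (EW : exp W = N) by (apply exp_ln; lra).
  assert (EW' : exp (- W) = / N) by (rewrite exp_Ropp, EW; reflexivity).
  assert (EP : / N ^ n = exp (- N * W)).
  { replace (- N * W) with (- (N * W)) by ring. unfold N at 2.
    rewrite exp_Ropp, <- exp_pow_INR, EW. reflexivity. }
  assert (HP : 0 < N ^ n) by (apply pow_lt; lra).
  (* [x] is [- N^z], so the combined integrand carries the factor [1 - (s / N)^(-z)]. On the ray
     [|s / N| >= 1], and both terms obey the same bound. *)
  set (x := - exp (z * W)).
  set (A := fun w th => PhiA (1 - (N + 1)) w th + x * PhiA (1 - (z + N + 1)) w th).
  set (B := fun w th => PhiB (1 - (N + 1)) w th + x * PhiB (1 - (z + N + 1)) w th).
  assert (Hcont : is_contour phi A B (hankel phi (N + 1) + x * hankel phi (z + N + 1))).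
  { apply (is_contour_combination PI phi x _ _ _ _ _ _ _ _ _ _ _ _
             (Phi_hol PI (1 - (N + 1))) (Phi_hol PI (1 - (z + N + 1))) Hphi);
      trivial; now apply hankel_correct. }
  replace (hankel phi (N + 1) - Rpower N z * hankel phi (z + N + 1))
    with (hankel phi (N + 1) + x * hankel phi (z + N + 1))
    by (unfold x, Rpower; fold W; ring).
  apply Rle_trans with ((2 / - cos phi * / N ^ n) * exp (- W) + z / kap * / N ^ n * (exp N / N)).
  2:{ rewrite EW'.
      replace ((2 / - cos phi + z / kap) * exp N / (N * N ^ n))
        with (2 / - cos phi * / N ^ n * / N * exp N + z / kap * / N ^ n * (exp N / N))
        by (field; lra).
      apply Rplus_le_compat_r. rewrite <- (Rmult_1_r (2 / - cos phi * / N ^ n * / N)) at 1.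
      apply Rmult_le_compat_l.
      - repeat apply Rmult_le_pos; try (apply Rlt_le, Rinv_0_lt_compat; lra); lra.
      - pose proof (exp_ineq1_le N). lra. }
  apply (is_contour_bound phi A B _ W _ _ Hcont).
  - intros w. apply (continuous_plus (fun w => PhiB (1 - (N + 1)) w phi)).
    + apply (hol_ray_continuous _ _ _ _ _ _ (Phi_hol PI (1 - (N + 1))) Hphi).
    + apply (continuous_scal_r x (fun w => PhiB (1 - (z + N + 1)) w phi)).
      apply (hol_ray_continuous _ _ _ _ _ _ (Phi_hol PI (1 - (z + N + 1))) Hphi).
  - intros w Hw.
    assert (Hray : exp (exp w * cos phi) <= / - cos phi * exp (- w)).
    { pose proof (exp_pos w).
      replace (exp w * cos phi) with (- (exp w * - cos phi)) by ring.
      rewrite !exp_Ropp, <- Rinv_mult.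
      apply Rinv_le_contravar; [apply Rmult_lt_0_compat; lra |].
      pose proof (exp_ineq1_le (exp w * - cos phi)). lra. }
    assert (H1 : Rabs (PhiB (1 - (N + 1)) w phi) <= / - cos phi * exp (- w) * / N ^ n).
    { eapply Rle_trans; [apply PhiB_abs_le |]. rewrite exp_plus.
      apply Rmult_le_compat; trivial; try (apply Rlt_le, exp_pos).
      rewrite EP. apply exp_monotone. nra. }
    assert (H2 : Rabs (x * PhiB (1 - (z + N + 1)) w phi) <= / - cos phi * exp (- w) * / N ^ n).
    { rewrite Rabs_mult. unfold x. rewrite Rabs_Ropp, (Rabs_pos_eq (exp _)) by apply Rlt_le, exp_pos.
      eapply Rle_trans.
      { apply Rmult_le_compat_l; [apply Rlt_le, exp_pos | apply PhiB_abs_le]. }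
      rewrite exp_plus.
      replace (exp (z * W) * (exp (exp w * cos phi) * exp ((1 - (z + N + 1)) * w)))
        with (exp (exp w * cos phi) * exp (z * W + (1 - (z + N + 1)) * w)) by (rewrite exp_plus; ring).
      apply Rmult_le_compat; trivial; try (apply Rlt_le, exp_pos).
      rewrite EP. apply exp_monotone. nra. }
    unfold B. eapply Rle_trans; [apply Rabs_triang |].
    replace (2 / - cos phi * / N ^ n * exp (- w))
      with (/ - cos phi * exp (- w) * / N ^ n + / - cos phi * exp (- w) * / N ^ n) by (field; lra).
    now apply Rplus_le_compat.
  (* On the arc [|s / N| = 1], so the two terms differ only by a phase [z * th]. Replacing [th] by
     [sin th / kap] makes the majorant an exact derivative of a multiple of [exp (N * cos th)],
     which gains the factor [1 / N]. *)
  - apply (Rle_trans _ (z / kap * / N ^ n * ((exp (N * cos 0) - exp (N * cos phi)) / N))).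
    2:{ rewrite cos_0, Rmult_1_r. pose proof (exp_pos (N * cos phi)).
        apply Rmult_le_compat_l.
        - apply Rmult_le_pos; [apply Rlt_le, Rdiv_lt_0_compat; lra |].
          apply Rlt_le, Rinv_0_lt_compat; lra.
        - apply Rmult_le_compat_r; [apply Rlt_le, Rinv_0_lt_compat; lra | lra]. }
    apply (norm_RInt_le (V := R_NormedModule) (A W)
             (fun th => z / kap * / N ^ n * (sin th * exp (N * cos th))) 0 phi (RInt (A W) 0 phi)).
    + lra.
    + intros th Hth. change (norm (A W th)) with (Rabs (A W th)).
      assert (EA : A W th = / N ^ n * exp (N * cos th)
                     * (cos (N * sin th - N * th) - cos (N * sin th - (z + N) * th))).
      { unfold A, x, PhiA. rewrite EW, EP.
        replace (N * cos th + (1 - (N + 1)) * W) with (- N * W + N * cos th) by ring.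
        replace (N * cos th + (1 - (z + N + 1)) * W) with (- (z * W) + (- N * W + N * cos th)) by ring.
        replace (N * sin th + (1 - (N + 1)) * th) with (N * sin th - N * th) by ring.
        replace (N * sin th + (1 - (z + N + 1)) * th) with (N * sin th - (z + N) * th) by ring.
        rewrite !exp_plus. rewrite (exp_Ropp (z * W)). field. apply Rgt_not_eq, exp_pos. }
      rewrite EA, Rabs_mult, Rabs_pos_eq.
      2:{ apply Rmult_le_pos; [apply Rlt_le, Rinv_0_lt_compat; lra | apply Rlt_le, exp_pos]. }
      replace (z / kap * / N ^ n * (sin th * exp (N * cos th)))
        with (/ N ^ n * exp (N * cos th) * (z * (sin th / kap))) by (field; lra).
      apply Rmult_le_compat_l.
      { apply Rmult_le_pos; [apply Rlt_le, Rinv_0_lt_compat; lra | apply Rlt_le, exp_pos]. }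
      eapply Rle_trans; [apply cos_lipschitz |].
      replace (N * sin th - N * th - (N * sin th - (z + N) * th)) with (z * th) by ring.
      rewrite Rabs_pos_eq by nra. apply Rmult_le_compat_l; [lra |].
      apply Rle_div_r; [assumption |]. rewrite Rmult_comm. now apply sin_ge_linear.
    + apply (RInt_correct (V := R_CompleteNormedModule)).
      apply (ex_RInt_continuous (V := R_CompleteNormedModule)). intros th Hth.
      rewrite Rmin_left in Hth by lra. rewrite Rmax_right in Hth by lra.
      assert (Hth' : Rabs th < PI) by (rewrite Rabs_pos_eq; lra).
      apply (continuous_plus (PhiA (1 - (N + 1)) W)).
      * apply (is_derive_continuous _ _ _ (hol_A_th _ _ _ _ _ (Phi_hol PI (1 - (N + 1))) W th Hth')).
      * apply (continuous_scal_r x (PhiA (1 - (z + N + 1)) W)).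
        apply (is_derive_continuous _ _ _ (hol_A_th _ _ _ _ _ (Phi_hol PI (1 - (z + N + 1))) W th Hth')).
    + replace (z / kap * / N ^ n * ((exp (N * cos 0) - exp (N * cos phi)) / N))
        with (minus (- (z / kap * / N ^ n / N) * exp (N * cos phi))
                    (- (z / kap * / N ^ n / N) * exp (N * cos 0)))
        by (unfold minus, plus, opp; simpl; field; lra).
      apply (is_RInt_derive (fun th => - (z / kap * / N ^ n / N) * exp (N * cos th))).
      * intros th _. auto_derive; [trivial | field; lra].
      * intros th _. apply (ex_derive_continuous (K := R_AbsRing) (V := R_NormedModule)).
        auto_derive. trivial.
Qed.

Lemma hankel_fact (phi : R) (n : nat) :
  is_hankel_angle phi -> INR (fact n) * hankel phi (INR n + 1) = hankel phi 1.
Proof.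
  intros Hphi. induction n as [| n IH].
  - simpl. rewrite Rplus_0_l. ring.
  - rewrite <- IH, (hankel_succ phi (INR n + 1) Hphi).
    change (fact (S n)) with (S n * fact n)%nat. rewrite mult_INR, S_INR. ring.
Qed.

Lemma hankel_prod_shift (phi z : R) (n : nat) :
  is_hankel_angle phi -> hankel phi z = prod_shift z n * hankel phi (z + INR n + 1).
Proof.
  intros Hphi. induction n as [| n IH].
  - simpl. rewrite Rplus_0_r. now apply hankel_succ.
  - rewrite IH, (hankel_succ phi (z + INR n + 1) Hphi).
    change (prod_shift z (S n)) with (prod_shift z n * (z + INR (S n))).
    rewrite S_INR. replace (z + (INR n + 1) + 1) with (z + INR n + 1 + 1) by ring. ring.
Qed.

(** Multiplying [hankel_shift_bound] by [n!] turns its first term into [h(1)] and, by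
    [fact_stirling_le], its error into a multiple of [1 / sqrt n]. *)
Lemma hankel_shift_limit (phi z : R) :
  is_hankel_angle phi -> 0 < z ->
  is_lim_seq (fun n => INR (fact n) * Rpower (INR n) z * hankel phi (z + INR n + 1)) (hankel phi 1).
Proof.
  intros Hphi Hz. destruct (hankel_shift_bound phi z Hphi Hz) as [C [HC Hb]].
  set (u := fun n => INR (fact n) * Rpower (INR n) z * hankel phi (z + INR n + 1)).
  assert (L : is_lim_seq (fun n => hankel phi 1 - u n) 0).
  { apply is_lim_seq_abs_0.
    apply (is_lim_seq_le_le_loc (fun _ => 0) _ (fun n => C * exp 1 * / sqrt (INR n))).
    - exists 1%nat. intros n Hn. split; [apply Rabs_pos |].
      assert (HN : 1 <= INR n) by (apply (le_INR 1); exact Hn).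
      specialize (Hb n Hn). pose proof (fact_stirling_le n Hn) as Hs.
      rewrite <- (hankel_fact phi n Hphi).
      assert (Hf : 0 < INR (fact n)) by apply INR_fact_lt_0.
      replace (INR (fact n) * hankel phi (INR n + 1) - u n)
        with (INR (fact n) * (hankel phi (INR n + 1) - Rpower (INR n) z * hankel phi (z + INR n + 1)))
        by (unfold u; ring).
      rewrite Rabs_mult, (Rabs_pos_eq (INR (fact n))) by lra.
      assert (Hp : 0 < INR n ^ n) by (apply pow_lt; lra).
      assert (Hq : 0 < sqrt (INR n)) by (apply sqrt_lt_R0; lra).
      apply Rle_trans with (INR (fact n) * (C * exp (INR n) / (INR n * INR n ^ n))).
      { apply Rmult_le_compat_l; lra. }
      replace (INR (fact n) * (C * exp (INR n) / (INR n * INR n ^ n)))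
        with (C / (INR n * INR n ^ n) * (INR (fact n) * exp (INR n))) by (field; lra).
      replace (C * exp 1 * / sqrt (INR n))
        with (C / (INR n * INR n ^ n) * (exp 1 * sqrt (INR n) * INR n ^ n)).
      2:{ rewrite <- (sqrt_sqrt (INR n)) at 1 by lra. field. lra. }
      apply Rmult_le_compat_l; [| exact Hs].
      apply Rlt_le, Rdiv_lt_0_compat; [lra | apply Rmult_lt_0_compat; lra].
    - apply is_lim_seq_const.
    - replace (Finite 0) with (Rbar_mult (C * exp 1) 0) by (simpl; f_equal; ring).
      apply is_lim_seq_scal_l.
      apply (is_lim_seq_inv (fun n => sqrt (INR n)) p_infty); [| discriminate].
      apply (filterlim_comp _ _ _ INR sqrt _ (Rbar_locally p_infty)).
      + apply is_lim_seq_INR.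
      + apply filterlim_sqrt_p. }
  apply (is_lim_seq_ext (fun n => hankel phi 1 - (hankel phi 1 - u n))); [intros n; ring |].
  replace (Finite (hankel phi 1)) with (Finite (hankel phi 1 - 0)) by (f_equal; ring).
  apply is_lim_seq_minus'; [apply is_lim_seq_const | exact L].
Qed.

Lemma prod_shift_pos (z : R) (n : nat) : 0 < z -> 0 < prod_shift z n.
Proof.
  intros Hz. induction n as [| n IH]; [assumption |].
  apply Rmult_lt_0_compat; [assumption |]. pose proof (pos_INR (S n)). lra.
Qed.

(** A zero at [z] would propagate through the recurrence to every [z + n + 1], making the limit in
    [hankel_shift_limit] zero instead of [h(1) > 0]. *)
Lemma hankel_neq0 (phi z : R) : is_hankel_angle phi -> 0 < z -> hankel phi z <> 0.
Proof.
  intros Hphi Hz H0. pose proof (hankel_1_pos phi Hphi) as H1.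
  assert (L : is_lim_seq (fun _ => 0) (hankel phi 1)).
  { apply (is_lim_seq_ext (fun n => INR (fact n) * Rpower (INR n) z * hankel phi (z + INR n + 1)));
      [| now apply hankel_shift_limit].
    intros n. pose proof (hankel_prod_shift phi z n Hphi) as H. rewrite H0 in H.
    pose proof (prod_shift_pos z n Hz).
    destruct (Rmult_integral _ _ (eq_sym H)) as [E | E]; [lra | rewrite E; ring]. }
  apply is_lim_seq_unique in L. rewrite Lim_seq_const in L. injection L as L. lra.
Qed.

(** [prod_shift z n = h(z) / h(z + n + 1)] turns Gauss's quotient into the sequence of
    [hankel_shift_limit] divided by [h(z)]. Once a limit exists, uniqueness pins the value chosen by
    [epsilon]. *)
Lemma Gamma_eq_hankel (phi z : R) :
  is_hankel_angle phi -> 0 < z -> Gamma z = hankel phi 1 / hankel phi z.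
Proof.
  intros Hphi Hz. pose proof (hankel_neq0 phi z Hphi Hz) as Hnz.
  assert (L : Un_cv (fun n => INR (fact n) * Rpower (INR n) z / prod_shift z n)
                (hankel phi 1 / hankel phi z)).
  { apply is_lim_seq_Reals.
    apply (is_lim_seq_ext (fun n => INR (fact n) * Rpower (INR n) z * hankel phi (z + INR n + 1)
                                    / hankel phi z)).
    - intros n. pose proof (prod_shift_pos z n Hz).
      rewrite (hankel_prod_shift phi z n Hphi) in Hnz |- *. field.
      split; [lra |]. intros E. apply Hnz. rewrite E. ring.
    - apply (is_lim_seq_scal_r _ (/ hankel phi z) (hankel phi 1)). now apply hankel_shift_limit. }
  unfold Gamma. eapply UL_sequence; [| exact L].
  apply (epsilon_spec (inhabits 0)
    (fun l => Un_cv (fun n => INR (fact n) * Rpower (INR n) z / prod_shift z n) l)).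
  eexists. exact L.
Qed.

(** * Mittag-Leffler functions as power series *)

(** For positive argument this is [h(1) / Gamma (b + beta k)]. Through [h] it also makes sense at
    [b = 0], where Gamma has a pole and the coefficient is 0. *)
Definition ml_coef (beta phi b : R) (k : nat) : R := hankel phi (b + beta * INR k).

Lemma PSeries_ml_coef (beta phi b x : R) :
  is_resolvent_angle beta phi -> 0 < x ->
  PSeries (ml_coef beta phi b) (- x) = resolvent beta phi x b.
Proof.
  intros Hang Hx. apply is_series_unique. now apply is_series_resolvent.
Qed.

(** The series converges at every [- x] with [x > 0], which excludes a finite radius. *)
Lemma CV_radius_ml_coef (beta phi b : R) :
  is_resolvent_angle beta phi -> CV_radius (ml_coef beta phi b) = p_infty.
Proof.
  intros Hang.
  assert (H : forall x, 0 < x -> ~ Rbar_lt (CV_radius (ml_coef beta phi b)) x).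
  { intros x Hx Hlt.
    apply (CV_disk_outside (ml_coef beta phi b) (- x)).
    - rewrite Rabs_Ropp, Rabs_pos_eq by lra. exact Hlt.
    - apply ex_series_lim_0. eexists. now apply is_series_resolvent. }
  pose proof (CV_radius_ge_0 (ml_coef beta phi b)) as H0.
  destruct (CV_radius (ml_coef beta phi b)) as [rho | |]; [| reflexivity | contradiction].
  simpl in H0. exfalso. apply (H (rho + 1)); simpl; lra.
Qed.

Lemma ML2_eq_PSeries (beta phi b z : R) :
  is_resolvent_angle beta phi -> 0 < b -> z < 0 ->
  ML2 beta b z = PSeries (ml_coef beta phi b) z / hankel phi 1.
Proof.
  intros Hang Hb Hz.
  pose proof (resolvent_angle_hankel _ _ Hang) as Hphi.
  pose proof (hankel_1_pos phi Hphi) as H1.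
  assert (L : infinite_sum (fun k => z ^ k / Gamma (INR k * beta + b))
                (PSeries (ml_coef beta phi b) z / hankel phi 1)).
  { apply is_series_Reals.
    apply (is_series_ext (fun k => / hankel phi 1 * (hankel phi (b + beta * INR k) * z ^ k))).
    - intros k.
      assert (Hk : 0 < INR k * beta + b).
      { pose proof (pos_INR k). destruct Hang. nra. }
      rewrite (Gamma_eq_hankel phi _ Hphi Hk).
      pose proof (hankel_neq0 phi _ Hphi Hk).
      replace (b + beta * INR k) with (INR k * beta + b) by ring.
      lazymatch goal with |- ?l = ?r => change (@eq R l r) end.
      field. split; [assumption | lra].
    - replace (PSeries (ml_coef beta phi b) z / hankel phi 1)
        with (/ hankel phi 1 * PSeries (ml_coef beta phi b) z) by (unfold Rdiv; ring).
      apply (is_series_scal_l (/ hankel phi 1) (fun k => hankel phi (b + beta * INR k) * z ^ k)).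
      replace z with (- - z) by ring. rewrite PSeries_ml_coef by (trivial; lra).
      apply is_series_resolvent; [assumption | lra]. }
  unfold ML2. eapply uniqueness_sum; [| exact L].
  apply (epsilon_spec (inhabits 0)
    (fun l => infinite_sum (fun k => z ^ k / Gamma (INR k * beta + b)) l)).
  eexists. exact L.
Qed.

(** The left side multiplies the [k]-th coefficient by [beta k + b - 1], which [hankel_succ]
    absorbs. For [z = r t^beta], where [beta z d/dz = t d/dt], this is the rule [(t^(b-1)
    E_{beta,b})' = t^(b-2) E_{beta,b-1}]. *)
Lemma PSeries_ml_coef_derive (beta phi b z : R) :
  is_resolvent_angle beta phi ->
  beta * (z * PSeries (PS_derive (ml_coef beta phi b)) z) + (b - 1) * PSeries (ml_coef beta phi b) z
  = PSeries (ml_coef beta phi (b - 1)) z.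
Proof.
  intros Hang. pose proof (resolvent_angle_hankel _ _ Hang) as Hphi.
  pose proof (CV_radius_ml_coef beta phi b Hang) as HR.
  rewrite <- PSeries_incr_1, <- !PSeries_scal, <- PSeries_plus.
  - apply PSeries_ext. intros k. unfold PS_plus, PS_scal, PS_incr_1, PS_derive, ml_coef.
    change plus with Rplus. change scal with Rmult.
    rewrite (hankel_succ phi (b - 1 + beta * INR k) Hphi).
    replace (b - 1 + beta * INR k + 1) with (b + beta * INR k) by ring.
    destruct k as [| k]; [change zero with 0; simpl; ring |].
    lazymatch goal with |- ?l = ?r => change (@eq R l r) end. ring.
  - apply ex_pseries_scal; [intros; apply Rmult_comm |].
    apply (ex_pseries_incr_1 (PS_derive (ml_coef beta phi b)) z), CV_radius_inside.
    rewrite CV_radius_derive, HR. exact I.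
  - apply ex_pseries_scal; [intros; apply Rmult_comm |]. apply CV_radius_inside. rewrite HR. exact I.
Qed.

Lemma is_derive_PSeries_Rpower (a : nat -> R) (beta r t : R) :
  CV_radius a = p_infty -> 0 < t ->
  is_derive (fun t => PSeries a (r * Rpower t beta)) t
    (beta * (r * Rpower t beta * PSeries (PS_derive a) (r * Rpower t beta)) / t).
Proof.
  intros HR Ht.
  assert (H1 : is_derive (fun t => r * Rpower t beta) t (r * (beta / t * Rpower t beta))).
  { unfold Rpower. auto_derive; [assumption | field; lra]. }
  assert (H2 : is_derive (PSeries a) (r * Rpower t beta) (PSeries (PS_derive a) (r * Rpower t beta))).
  { apply is_derive_PSeries. rewrite HR. exact I. }
  evar_last; [exact (is_derive_comp (PSeries a) (fun t => r * Rpower t beta) t _ _ H2 H1) |].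
  change scal with Rmult. lazymatch goal with |- ?l = ?r => change (@eq R l r) end. field. lra.
Qed.

(** * Asymptotics for large [t] and the limit of [t u' / u] *)

(** By [hankel_resolvent] at [b - beta], the difference from the limit is [J_{b-beta}(x)], of order
    [1 / x]; since [beta > 1], this is of order [1 / t]. *)
Lemma is_lim_scaled_resolvent (beta phi b lam : R) :
  is_resolvent_angle beta phi -> 0 < lam ->
  is_lim (fun t => lam * Rpower t beta * resolvent beta phi (lam * Rpower t beta) b)
    p_infty (hankel phi (b - beta)).
Proof.
  intros Hang Hlam. assert (Hb : 1 < beta) by (destruct Hang; lra).
  destruct (resolvent_abs_le_inv beta phi (b - beta) Hang) as [C [HC Hbound]].
  assert (Hx : forall t, 0 < lam * Rpower t beta).
  { intros t. apply Rmult_lt_0_compat; [assumption | apply exp_pos]. }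
  assert (Hinv : is_lim (fun t => C / lam * / t) p_infty 0).
  { replace (Finite 0) with (Rbar_mult (C / lam) 0) by (simpl; f_equal; ring).
    apply is_lim_scal_l.
    apply (is_lim_inv (fun t => t) p_infty p_infty); [apply is_lim_id | discriminate]. }
  apply (is_lim_ext (fun t => hankel phi (b - beta)
                              - resolvent beta phi (lam * Rpower t beta) (b - beta))).
  { intros t. rewrite (hankel_resolvent beta phi _ (b - beta) Hang (Hx t)).
    replace (b - beta + beta) with b by ring. ring. }
  replace (Finite (hankel phi (b - beta))) with (Finite (hankel phi (b - beta) - 0))
    by (f_equal; ring).
  apply is_lim_minus'; [apply is_lim_const |].
  assert (Hle : forall t, 1 < t -> Rabs (resolvent beta phi (lam * Rpower t beta) (b - beta))
                                   <= C / lam * / t).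
  { intros t Ht. eapply Rle_trans; [apply Hbound, Hx |].
    assert (Hp : t <= Rpower t beta).
    { rewrite <- (Rpower_1 t) at 1 by lra. apply Rle_Rpower; lra. }
    replace (C / lam * / t) with (C / (lam * t)) by (field; lra).
    apply Rmult_le_compat_l; [lra |]. apply Rinv_le_contravar; nra. }
  apply (is_lim_le_le_loc (fun t => - (C / lam * / t)) (fun t => C / lam * / t)).
  - exists 1. intros t Ht. apply Rabs_le_between, Hle, Ht.
  - replace (Finite 0) with (Rbar_opp 0) by (simpl; f_equal; ring).
    now apply is_lim_opp.
  - exact Hinv.
Qed.

(* u(t) = E_beta(r t^beta) + t E_{beta,2}(r t^beta), t > 0;
   beta = 1 - lim_{t->oo} t u'(t)/u(t). *)
Theorem theorem3 (beta r : R) (hb1 : 1 < beta) (hb2 : beta < 2) (hr : r < 0) :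
  let u := fun t => ML beta (r * Rpower t beta) + t * ML2 beta 2 (r * Rpower t beta) in
  (forall t, 0 < t -> exists l, derivable_pt_lim u t l) /\
  (forall du : R -> R,
     (forall t, 0 < t -> derivable_pt_lim u t (du t)) ->
     exists L, lim_pinfty (fun t => t * du t / u t) L /\ beta = 1 - L).
Proof.
  intros u. pose proof PI_RGT_0 as HPI.
  assert (Hgap : PI / 2 < PI / beta).
  { apply Rmult_lt_compat_l; [assumption |]. apply Rinv_lt_contravar; lra. }
  (* Any angle strictly between [PI / 2] and [PI / beta] would do; the interval is nonempty because
     [beta < 2]. *)
  set (phi := (PI / 2 + PI / beta) / 2).
  assert (Hang : is_resolvent_angle beta phi) by (split; [lra | unfold phi; lra]).
  pose proof (resolvent_angle_hankel _ _ Hang) as Hphi.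
  pose proof (hankel_1_pos phi Hphi) as H1.
  set (h1 := hankel phi 1) in *.
  set (F := fun b t => PSeries (ml_coef beta phi b) (r * Rpower t beta)).
  assert (Hz : forall t, 0 < - r * Rpower t beta).
  { intros t. apply Rmult_lt_0_compat; [lra | apply exp_pos]. }
  assert (HF : forall b t, F b t = resolvent beta phi (- r * Rpower t beta) b).
  { intros b t. rewrite <- PSeries_ml_coef by trivial. unfold F. f_equal. ring. }
  assert (Hu : forall t, u t = (F 1 t + t * F 2 t) / h1).
  { intros t. specialize (Hz t). unfold u, ML.
    rewrite !(ML2_eq_PSeries beta phi) by (trivial; lra). unfold F, h1. field. fold h1. lra. }
  assert (HFd : forall b t, 0 < t -> is_derive (F b) t ((F (b - 1) t - (b - 1) * F b t) / t)).
  { intros b t Ht. evar_last.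
    - apply is_derive_PSeries_Rpower; [| exact Ht]. now apply CV_radius_ml_coef.
    - simpl. unfold F at 1. rewrite <- (PSeries_ml_coef_derive beta phi b) by assumption.
      unfold F. field. lra. }
  (* [F 1] has derivative [F 0 / t], and in the derivative of [t * F 2] the terms in [F 2] cancel,
     leaving [F 1]. *)
  assert (Hd : forall t, 0 < t -> derivable_pt_lim u t ((F 0 t + t * F 1 t) / (h1 * t))).
  { intros t Ht. apply is_derive_Reals.
    apply (is_derive_ext (fun t => (F 1 t + t * F 2 t) / h1)); [intros; symmetry; apply Hu |].
    pose proof (HFd 1 t Ht) as D1. pose proof (HFd 2 t Ht) as D2.
    replace (1 - 1) with 0 in D1 by ring. replace (2 - 1) with 1 in D2 by ring.
    auto_derive.
    - split; [eexists; exact D1 |]. split; [eexists; exact D2 | trivial].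
    - rewrite (is_derive_unique (fun x : R => F 1 x) t _ D1), (is_derive_unique (fun x : R => F 2 x) t _ D2).
      field. lra. }
  split; [intros t Ht; eexists; now apply Hd |].
  intros du Hdu. exists (1 - beta). split; [| ring].
  set (x := fun t => - r * Rpower t beta).
  (* Numerator and denominator of [t u' / u] are both scaled by [x / t]: each [G b] has a finite
     limit, and the terms divided by [t] drop out. *)
  set (G := fun b t => x t * F b t).
  assert (HG : forall b, is_lim (G b) p_infty (hankel phi (b - beta))).
  { intros b. apply (is_lim_ext (fun t => - r * Rpower t beta * resolvent beta phi (- r * Rpower t beta) b)).
    - intros t. unfold G, x. now rewrite HF.
    - apply is_lim_scaled_resolvent; [assumption | lra]. }
  assert (Hinv : is_lim (fun t => / t) p_infty 0).
  { apply (is_lim_inv (fun t => t) p_infty p_infty); [apply is_lim_id | discriminate]. }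
  assert (HN : forall b c, is_lim (fun t => G b t * / t + G c t) p_infty (hankel phi (c - beta))).
  { intros b c. replace (Finite (hankel phi (c - beta)))
      with (Finite (hankel phi (b - beta) * 0 + hankel phi (c - beta))) by (f_equal; ring).
    apply is_lim_plus'; [| apply HG].
    apply (is_lim_mult (G b) (fun t => / t) p_infty (hankel phi (b - beta)) 0); [apply HG | exact Hinv | exact I]. }
  assert (Hnz : hankel phi (2 - beta) <> 0) by (apply hankel_neq0; [assumption | lra]).
  assert (L : is_lim (fun t => (G 0 t * / t + G 1 t) / (G 1 t * / t + G 2 t)) p_infty (1 - beta)).
  { replace (1 - beta) with (hankel phi (1 - beta) / hankel phi (2 - beta)).
    - apply (is_lim_div _ _ p_infty (hankel phi (1 - beta)) (hankel phi (2 - beta))).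
      + apply HN.
      + apply HN.
      + intros E. injection E. exact Hnz.
      + exact I.
    (* [1 - beta] is negative, out of reach of [Gamma_eq_hankel]; the recurrence alone gives the
       ratio. *)
    - rewrite (hankel_succ phi (1 - beta) Hphi).
      replace (1 - beta + 1) with (2 - beta) by ring. field. exact Hnz. }
  intros eps Heps. apply is_lim_spec in L. destruct (L (mkposreal eps Heps)) as [M HM].
  (* The maximum with 0 secures [t > 0], where the derivative formula holds. *)
  exists (Rmax M 0). intros t Ht. apply Rmax_Rlt in Ht. destruct Ht as [HtM Ht].
  specialize (HM t HtM). simpl in HM.
  replace (t * du t / u t) with ((G 0 t * / t + G 1 t) / (G 1 t * / t + G 2 t)); [exact HM |].
  rewrite (uniqueness_limite u t (du t) _ (Hdu t Ht) (Hd t Ht)), Hu.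
  pose proof (Hz t) as Hxt. fold (x t) in Hxt.
  replace (G 0 t * / t + G 1 t) with (x t / t * (F 0 t + t * F 1 t)) by (unfold G; field; lra).
  replace (G 1 t * / t + G 2 t) with (x t / t * (F 1 t + t * F 2 t)) by (unfold G; field; lra).
  replace (t * ((F 0 t + t * F 1 t) / (h1 * t))) with (/ h1 * (F 0 t + t * F 1 t)) by (field; lra).
  replace ((F 1 t + t * F 2 t) / h1) with (/ h1 * (F 1 t + t * F 2 t)) by (unfold Rdiv; ring).
  rewrite !Rdiv_mult_l_l; [reflexivity | |].
  - apply Rinv_neq_0_compat. lra.
  - apply Rgt_not_eq, Rdiv_lt_0_compat; lra.
Qed.
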